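(* Let $h$ be a proper, lower semicontinuous, sublinear function on $\mathbb{R}^n$ and let $D$ be the unique closed, convex set in $\mathbb{R}^n$ such that $h=\sigma_D$. For each $x\in(D^\infty)^*$, denote by $$F_{D,x}:=\operatorname*{arg\,max}_{v\in D}\langle v,x\rangle$$ the (possibly empty) face of $D$ exposed by $x$, and by $$F_{D^\infty,x}:=\operatorname*{arg\,max}_{v\in D^\infty}\langle v,x\rangle$$ the nonempty face of $D^\infty$ exposed also by $x$. Then the equality $$(F_{D,x})^\infty=F_{D^\infty,x}$$ holds for all $x\in(D^\infty)^*$ with $F_{D,x}\ne\emptyset$. Moreover, the following properties hold: (a) $\partial_{\operatorname{dom}h}h(0)$ is nonempty and closed with $$\partial_{\operatorname{dom}h}h(0)=\operatorname{cl}\bigcup_{x\in(D^\infty)^*}\operatorname{proj}_{(F_{D^\infty,x})^*}F_{D,x}\quad\text{and}\quad\partial^\infty_{\operatorname{dom}h}h(0)=(\partial_{\operatorname{dom}h}h(0))^\infty.$$ In particular, $\partial_{\operatorname{dom}h}h(0)$ contains the projections of $D$ on $(D^\infty)^*$, as well as all the bounded exposed faces of $D$. (b) $h$ is locally Lipschitz continuous at $0$ relative to $\operatorname{dom}h$ if and only if $\partial_{\operatorname{dom}h}h(0)$ is bounded. (c) We have $$\operatorname{lip}_{\operatorname{dom}h}h(0)=\sup_{v\in\partial_{\operatorname{dom}h}h(0)}\|v\|=\sup_{x\in(D^\infty)^*}e(F_{D,x},F_{D^\infty,x}).$$ (d) If $D$ is polyhedral, or in other words $h$ is piecewise linear, then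 $\partial_{\operatorname{dom}h}h(0)$ is bounded.
   Context: $\operatorname{dom}h=\{x\mid h(x)<+\infty\}$. The support function of $D$ is $\sigma_D(x)=\sup_{v\in D}\langle v,x\rangle$. For a set $A\subset\mathbb{R}^n$: $A^\infty=\{x\mid\exists x_k\in A,\ \lambda_k\downarrow0\text{ with }\lambda_kx_k\to x\}$ is the horizon cone; $A^*=\{v\mid\langle v,x\rangle\le0\ \forall x\in A\}$ is the polar cone; $\operatorname{cl}A$ is the closure. An exposed face of a convex set $C$ is a set of the form $\operatorname*{arg\,max}_{v\in C}\langle x,v\rangle$ for some $x\in\mathbb{R}^n$. $\operatorname{proj}_A(x)$ is the set of points of $A$ nearest to $x$, $\operatorname{proj}_AM=\bigcup_{x\in M}\operatorname{proj}_A(x)$, $\operatorname{proj}_A\emptyset=\emptyset$. The excess of $A$ over a nonempty set $B$ is $e(A,B)=\sup\{d(x,B)\mid x\in A\}$, with $e(\emptyset,B)=0$, where $d(x,B)=\inf_{y\in B}\|y-x\|$. For a set $X$ and $\bar{x}\in X$ with $f$ finite on $X$: $\operatorname{lip}_Xf(\bar{x})=\limsup_{x,x'\to\bar{x};\ x,x'\in X,\ x\ne x'}\frac{|f(x)-f(x')|}{\|x-x'\|}$ (equal to $0$ if $\bar{x}$ is isolated in $X$), and $f$ is locally Lipschitz continuous at $\bar{x}$ relative to $X$ if $\operatorname{lip}_Xf(\bar{x})<+\infty$. $T_X(x)$ is the tangent (contingent) cone: all $w$ for which there exist $t_k\downarrow0$, $w_k\to w$ with $x+t_kw_k\in X$.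 $\delta_X$ is the indicator function of $X$ ($0$ on $X$, $+\infty$ elsewhere). At a point $x$ with $g(x)$ finite, $v\in\widehat{\partial}g(x)$ if $g(y)\ge g(x)+\langle v,y-x\rangle+o(\|y-x\|)$; $v\in\partial g(x)$ if there are $x_k\to x$ with $g(x_k)\to g(x)$ and $v_k\in\widehat{\partial}g(x_k)$ with $v_k\to v$. Projectional subgradients (for a convex set $X$, $\bar{x}\in X$, $f(\bar{x})$ finite): $v\in\partial_Xf(\bar{x})$ if there are $x_k\to\bar{x}$ with $x_k\in X$, $f(x_k)\to f(\bar{x})$, and $v_k\in\partial(f+\delta_X)(x_k)$ with $\operatorname{proj}_{T_X(x_k)}(v_k)\to v$; $v\in\partial_X^\infty f(\bar{x})$ if there are $\lambda_k\downarrow0$, $x_k\to\bar{x}$ with $x_k\in X$, $f(x_k)\to f(\bar{x})$, and $v_k\in\partial(f+\delta_X)(x_k)$ with $\lambda_k\operatorname{proj}_{T_X(x_k)}(v_k)\to v$. These are applied with $f=h$, $X=\operatorname{dom}h$ (a convex cone, not necessarily closed), $\bar{x}=0$. *)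

(* Defs.v *)
From mathcomp Require Import all_boot all_order all_algebra.
From mathcomp Require Import all_classical all_reals.
From mathcomp Require Import ereal topology normedtype sequences convex.

Set Implicit Arguments.
Unset Strict Implicit.
Unset Printing Implicit Defensive.

Import Order.TTheory GRing.Theory Num.Theory.
Import numFieldNormedType.Exports.

Local Open Scope classical_set_scope.
Local Open Scope ring_scope.

(* The library norm on 'rV[R]_n is the sup norm.  It is used here only for its
   topology and its bounded sets, which are the Euclidean ones; every distance
   and every projection below is taken with respect to [enorm]. *)

Section euclidean.
Context {R : realType} {n : nat}.
Implicit Types (x y v : 'rV[R]_n) (A B C : set 'rV[R]_n).

Definition dot x y : R := \sum_(i < n) x ord0 i * y ord0 i.

Definition enorm x : R := Num.sqrt (dot x x).

Definition proj A x : set 'rV[R]_n :=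
  [set y | A y /\ forall z, A z -> enorm (y - x) <= enorm (z - x)].

Definition proj_set A M : set 'rV[R]_n := \bigcup_(x in M) proj A x.

Definition dist x B : \bar R := ereal_inf [set (enorm (y - x))%:E | y in B].

(* [ereal_sup set0] is -oo, hence the separate case. *)
Definition excess A B : \bar R :=
  if A == set0 then 0%E else ereal_sup [set dist x B | x in A].

(* Here and below, lambda_k decreasing to 0 means lambda_k > 0 and
   lambda_k --> 0, as is usual in variational analysis. *)
Definition horizon_cone A : set 'rV[R]_n :=
  [set x | exists (x_ : nat -> 'rV[R]_n) (l_ : nat -> R),
    [/\ forall k, A (x_ k), forall k, 0 < l_ k, l_ @ \oo --> (0 : R)
      & (fun k => l_ k *: x_ k) @ \oo --> x]].

Definition polar_cone A : set 'rV[R]_n :=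
  [set v | forall x, A x -> dot v x <= 0].

Definition tangent_cone A x : set 'rV[R]_n :=
  [set w | exists (t_ : nat -> R) (w_ : nat -> 'rV[R]_n),
    [/\ forall k, 0 < t_ k, t_ @ \oo --> (0 : R), w_ @ \oo --> w
      & forall k, A (x + t_ k *: w_ k)]].

Definition face C x : set 'rV[R]_n :=
  [set v | C v /\ forall u, C u -> dot u x <= dot v x].

Definition exposed_face C (F : set 'rV[R]_n) : Prop := exists x, F = face C x.

(* A zero normal [a i] is allowed; it only adds the empty set, and the whole
   space is obtained with m = 0. *)
Definition polyhedral C : Prop :=
  exists (m : nat) (a : 'I_m -> 'rV[R]_n) (b : 'I_m -> R),
    C = [set v | forall i, dot (a i) v <= b i].

End euclidean.

Section extended_real_functions.
Context {R : realType} {n : nat}.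
Implicit Types (f g h : 'rV[R]_n -> \bar R) (x v : 'rV[R]_n).
Implicit Types (X D : set 'rV[R]_n).

Definition effdom f : set 'rV[R]_n := [set x | (f x < +oo)%E].

Definition proper_fun f : Prop :=
  (exists x, (f x < +oo)%E) /\ (forall x, (-oo < f x)%E).

Definition sublinear f : Prop :=
  [/\ effdom f 0,
      forall (l : R) x, 0 < l -> f (l *: x) = (l%:E * f x)%E
    & forall x y, (f (x + y)%R <= f x + f y)%E].

Definition support_fun D x : \bar R := ereal_sup [set (dot v x)%:E | v in D].

Definition piecewise_linear f : Prop :=
  exists (m : nat) (C : 'I_m -> set 'rV[R]_n) (a : 'I_m -> 'rV[R]_n)
    (b : 'I_m -> R),
    [/\ forall i, polyhedral (C i),
        effdom f = \bigcup_i C i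
      & forall i x, C i x -> f x = (dot (a i) x + b i)%:E].

Definition indicator X x : \bar R := if x \in X then 0%E else +oo%E.

(* Meant for f finite on X, whence [fine].  The filter is improper, and the
   library limsup is -oo, when x0 is isolated in X. *)
Definition lip X f x0 : \bar R :=
  if `[< isolated X x0 >] then 0%E else
  limf_esup
    (fun p : 'rV[R]_n * 'rV[R]_n =>
      (`|fine (f p.1) - fine (f p.2)| / enorm (p.1 - p.2))%:E)
    (within [set p : 'rV[R]_n * 'rV[R]_n | [/\ X p.1, X p.2 & p.1 != p.2]]
      (nbhs (x0, x0))).

Definition locally_lipschitz_rel X f x0 : Prop := (lip X f x0 < +oo)%E.

(* The epsilon form of g(y) >= g(x) + <v, y - x> + o(|y - x|). *)
Definition regular_subdiff g x : set 'rV[R]_n :=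
  [set v | g x \is a fin_num /\
    forall e : R, 0 < e -> \forall y \near x,
      (g x + (dot v (y - x) - e * enorm (y - x))%:E <= g y)%E].

Definition subdiff g x : set 'rV[R]_n :=
  [set v | g x \is a fin_num /\
    exists x_ v_ : nat -> 'rV[R]_n,
    [/\ x_ @ \oo --> x, (g \o x_) @ \oo --> g x,
        forall k, regular_subdiff g (x_ k) (v_ k) & v_ @ \oo --> v]].

(* For X convex, T_X(x_k) is a nonempty closed convex cone, so the projection
   w_k of v_k on it exists and is unique. *)
Definition proj_subdiff X f x : set 'rV[R]_n :=
  [set v | exists x_ v_ w_ : nat -> 'rV[R]_n,
    [/\ [/\ forall k, X (x_ k), x_ @ \oo --> x & (f \o x_) @ \oo --> f x],
        forall k, subdiff (fun y => f y + indicator X y)%E (x_ k) (v_ k),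
        forall k, proj (tangent_cone X (x_ k)) (v_ k) (w_ k)
      & w_ @ \oo --> v]].

Definition horizon_proj_subdiff X f x : set 'rV[R]_n :=
  [set v | exists (x_ v_ w_ : nat -> 'rV[R]_n) (l_ : nat -> R),
    [/\ (forall k, 0 < l_ k) /\ l_ @ \oo --> (0 : R),
        [/\ forall k, X (x_ k), x_ @ \oo --> x & (f \o x_) @ \oo --> f x],
        forall k, subdiff (fun y => f y + indicator X y)%E (x_ k) (v_ k),
        forall k, proj (tangent_cone X (x_ k)) (v_ k) (w_ k)
      & (fun k => l_ k *: w_ k) @ \oo --> v]].

End extended_real_functions.

(* Main.v *)
Require Import Defs.
From mathcomp Require Import all_boot all_order all_algebra.
From mathcomp Require Import all_classical all_reals.
From mathcomp Require Import ereal topology normedtype sequences convex.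
From mathcomp Require Import derive realfun.
From mathcomp Require Import ring lra.

(** Let [X] be the domain of [h], a convex cone, and write F(x) for the face of
    [D] exposed by [x] and G(x) for the face of [horizon_cone D] exposed by [x].

    By separation, [D] is the set of the [v] with [dot v x <= h x] on [X]
    ([mem_support]).  Hence [horizon_cone D] is the polar cone of [X]
    ([horizon_support]), G(x) is the set of horizon directions orthogonal to [x],
    and this is the horizon cone of F(x) when F(x) is nonempty ([horizon_face]).
    For [x] in [X], convexity makes F(x) the subdifferential of [h] at [x]
    ([subdiff_support]), and the bipolar theorem makes the tangent cone of [X] at
    [x] the polar cone of G(x) ([tangent_effdom]).  Neither F(x) nor G(x) changes
    when [x] is multiplied by a positive number, so the condition that the base
    points tend to 0 costs nothing: the projectional subdifferential is the
    closure of [projected_faces D], the union of the projections of the F(x) on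
    the polar cones of the G(x) ([proj_subdiff_closure]).  The statements about
    horizon subgradients, about the projection of [D] and about bounded faces
    follow from this description.

    By homogeneity the Lipschitz modulus at 0 is the best global Lipschitz
    constant of [h] on [X] ([lip_le_lipschitz]).  The key point is that a constant
    [L] is a Lipschitz constant exactly when it bounds [projected_faces D]
    ([lipschitz_projected_faces]).  One direction follows the projection [w] of
    a subgradient as a tangent direction, along which [h] grows at rate at least
    [enorm w ^+ 2].  For the other one, take a point [y] of the relative interior
    of [X].  Subgradients exist there ([core_face_nonempty]) and the normal cone
    G(y) is orthogonal to [X].  So the subgradient inequality still holds with
    a projected subgradient ([core_lipschitz]).  A general pair of points is
    shifted into the relative interior by a common small vector.  Moreau's
    decomposition identifies the norm of a projected subgradient with the distance
    of the subgradient to G(x), which yields the excess formula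
    ([sup_enorm_excess]).

    Polyhedral sets are treated through the theorems of Weyl and Minkowski
    ([gcone_hcone], [hcone_gcone]), obtained by eliminating one variable at
    a time.  They make the support function of a polyhedral set a maximum of
    finitely many linear forms on a polyhedral domain, hence piecewise linear and
    Lipschitz, and they turn the inequalities [dot v x <= h x] over a polyhedral
    piece into finitely many. *)

Set Implicit Arguments.
Unset Strict Implicit.
Unset Printing Implicit Defensive.

Import Order.TTheory GRing.Theory Num.Theory.
Import numFieldNormedType.Exports.

Local Open Scope classical_set_scope.
Local Open Scope ring_scope.

(* [proj] also names the coordinate maps of a product space. *)
Local Notation proj := Defs.proj.

(** * Euclidean inner product, norm and convergence *)

(** Reduces an equality between suprema to statements about one real bound. *)
Lemma eq_ereal_ge0 {R : realType} (x y : \bar R) : (0 <= x)%E -> (0 <= y)%E ->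
  (forall L : R, 0 <= L -> (x <= L%:E)%E <-> (y <= L%:E)%E) -> x = y.
Proof.
move=> x0 y0 xy.
suff uv (u v : \bar R) : (0 <= v)%E ->
    (forall L : R, 0 <= L -> (v <= L%:E)%E -> (u <= L%:E)%E) -> (u <= v)%E.
  by apply/eqP; rewrite eq_le; apply/andP; split; apply: uv => // L /xy[].
case: v => [r||]//; first by rewrite lee_fin => r0; apply.
by move=> _ _; rewrite leey.
Qed.

Lemma exists_max_seq {R : realType} (T : eqType) (s : seq T) (f : T -> R) :
  s != [::] ->
  exists2 i, i \in s & forall j, j \in s -> f j <= f i.
Proof.
elim: s => // k s IH _; have [->|/IH[i si imax]] := eqVneq s [::].
  by exists k => [|j]; rewrite inE ?eqxx// => /eqP ->.
have [ik|/ltW ki] := leP (f i) (f k).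
  exists k => [|j]; first exact: mem_head.
  by rewrite inE => /predU1P[->//|/imax ji]; exact: le_trans ji ik.
exists i => [|j]; first by rewrite inE si orbT.
by rewrite inE => /predU1P[->//|/imax].
Qed.

Section Euclidean.
Context {R : realType} {n : nat}.
Implicit Types (x y z u v w : 'rV[R]_n) (A B C K : set 'rV[R]_n) (s t c e : R).

Lemma dotC x y : dot x y = dot y x.
Proof. by apply: eq_bigr => i _; rewrite mulrC. Qed.

Lemma dotDl x y z : dot (x + y) z = dot x z + dot y z.
Proof. by rewrite /dot -big_split; apply: eq_bigr => i _; rewrite mxE mulrDl. Qed.

Lemma dotZl t x y : dot (t *: x) y = t * dot x y.
Proof. by rewrite /dot mulr_sumr; apply: eq_bigr => i _; rewrite mxE mulrA. Qed.

Lemma dotNl x y : dot (- x) y = - dot x y.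
Proof. by rewrite -scaleN1r dotZl mulN1r. Qed.

Lemma dotBl x y z : dot (x - y) z = dot x z - dot y z.
Proof. by rewrite dotDl dotNl. Qed.

Lemma dot0l x : dot 0 x = 0.
Proof. by rewrite -(scale0r x) dotZl mul0r. Qed.

Lemma dotDr x y z : dot z (x + y) = dot z x + dot z y.
Proof. by rewrite dotC dotDl !(dotC z). Qed.

Lemma dotZr t x y : dot x (t *: y) = t * dot x y.
Proof. by rewrite dotC dotZl dotC. Qed.

Lemma dotNr x y : dot x (- y) = - dot x y.
Proof. by rewrite dotC dotNl dotC. Qed.

Lemma dotBr x y z : dot z (x - y) = dot z x - dot z y.
Proof. by rewrite dotDr dotNr. Qed.

Lemma dot0r x : dot x 0 = 0.
Proof. by rewrite dotC dot0l. Qed.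

Definition dotE := (dotDl, dotNl, dotZl, dot0l, dotDr, dotNr, dotZr, dot0r).

Lemma dot_ge0 x : 0 <= dot x x.
Proof. by apply: sumr_ge0 => i _; rewrite -expr2 sqr_ge0. Qed.

Lemma dot_eq0 x : (dot x x == 0) = (x == 0).
Proof.
apply/idP/eqP => [|->]; last by rewrite dot0l.
rewrite psumr_eq0 => [/allP x0|i _]; last by rewrite -expr2 sqr_ge0.
apply/rowP => i; rewrite mxE; have := x0 i (mem_index_enum _).
by rewrite /= mulf_eq0 orbb => /eqP.
Qed.

Lemma enorm_ge0 x : 0 <= enorm x.
Proof. exact: sqrtr_ge0. Qed.

Lemma enorm_sqr x : enorm x ^+ 2 = dot x x.
Proof. by rewrite sqr_sqrtr// dot_ge0. Qed.

Lemma enorm_eq0 x : (enorm x == 0) = (x == 0).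
Proof. by rewrite -sqrf_eq0 enorm_sqr dot_eq0. Qed.

Lemma enorm0 : enorm (0 : 'rV[R]_n) = 0.
Proof. by apply/eqP; rewrite enorm_eq0. Qed.

Lemma enorm_gt0 x : (0 < enorm x) = (x != 0).
Proof. by rewrite lt_def enorm_ge0 andbT enorm_eq0. Qed.

Lemma enormZ t x : enorm (t *: x) = `|t| * enorm x.
Proof. by rewrite /enorm !dotE mulrA -expr2 sqrtrM ?sqr_ge0// sqrtr_sqr. Qed.

Lemma enormN x : enorm (- x) = enorm x.
Proof. by rewrite -scaleN1r enormZ normrN1 mul1r. Qed.

Lemma enormB x y : enorm (x - y) = enorm (y - x).
Proof. by rewrite -enormN opprB. Qed.

Lemma ler_enorm x y : (enorm x <= enorm y) = (dot x x <= dot y y).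
Proof. by rewrite -!enorm_sqr ler_sqr ?nnegrE ?enorm_ge0. Qed.

Lemma cauchy_schwarz x y : dot x y <= enorm x * enorm y.
Proof.
have [->|y0] := eqVneq y 0; first by rewrite dot0r enorm0 mulr0.
have yy : 0 < dot y y by rewrite lt_def dot_eq0 y0 dot_ge0.
have := dot_ge0 (dot y y *: x - dot x y *: y).
rewrite !dotE (dotC y x) => h.
have {}h : dot x y ^+ 2 <= (enorm x * enorm y) ^+ 2.
  rewrite exprMn !enorm_sqr; nra.
rewrite (le_trans (ler_norm _))// -(@ler_pXn2r _ 2) ?nnegrE//.
  by rewrite real_normK ?num_real//.
by rewrite mulr_ge0 ?enorm_ge0.
Qed.

Lemma ler_enormD x y : enorm (x + y) <= enorm x + enorm y.
Proof.
rewrite -(@ler_pXn2r _ 2) ?nnegrE ?addr_ge0 ?enorm_ge0// enorm_sqr.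
rewrite sqrrD !enorm_sqr !dotE (dotC y x).
have := cauchy_schwarz x y; lra.
Qed.

(** With [enorm_le_norm]: the norm of ['rV[R]_n], which is the sup norm, has the
    Euclidean topology and bounded sets. *)
Lemma norm_le_enorm x : `|x| <= enorm x.
Proof.
have [->|/eqP x0] := eqVneq `|x| 0; first exact: enorm_ge0.
have /mx_norm_neq0[[i j] /= xij] : mx_norm x != 0 by apply/eqP.
rewrite [`|x|]xij -(@ler_pXn2r _ 2) ?nnegrE ?enorm_ge0// enorm_sqr.
rewrite real_normK ?num_real//.
rewrite (ord1 i) /dot (bigD1 j)//= -expr2 lerDl.
by apply: sumr_ge0 => k _; rewrite -expr2 sqr_ge0.
Qed.

Lemma coord_le_norm x i : `|x ord0 i| <= `|x|.
Proof.
rewrite [leRHS]mx_normrE; exact: (le_bigmax _ (fun k => `|x k.1 k.2|) (ord0, i)).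
Qed.

Lemma enorm_le_norm x : enorm x <= Num.sqrt n%:R * `|x|.
Proof.
rewrite -[`|x|]ger0_norm// -sqrtr_sqr -sqrtrM ?ler0n// ler_sqrt.
  rewrite /dot [leRHS](_ : _ = \sum_(i < n) `|x| ^+ 2).
    apply: ler_sum => i _; rewrite -expr2 -real_normK ?num_real//.
    by rewrite ler_pXn2r ?nnegrE// coord_le_norm.
  by rewrite sumr_const card_ord mulr_natl.
by rewrite mulr_ge0 ?sqr_ge0 ?ler0n.
Qed.

Lemma cvg_dot (T : Type) (F : set_system T) {FF : Filter F}
    (f g : T -> 'rV[R]_n) x y :
  f @ F --> x -> g @ F --> y -> (fun k => dot (f k) (g k)) @ F --> dot x y.
Proof.
move=> fx gy; apply: cvg_big => [|i _]; first exact: add_continuous.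
apply: cvgM.
  exact: (continuous_cvg FF (@coord_continuous R 1 n ord0 i x) fx).
exact: (continuous_cvg FF (@coord_continuous R 1 n ord0 i y) gy).
Qed.

Lemma cvg_enorm (T : Type) (F : set_system T) {FF : Filter F}
    (f : T -> 'rV[R]_n) x :
  f @ F --> x -> (fun k => enorm (f k)) @ F --> enorm x.
Proof.
move=> fx; exact: (continuous_cvg FF (@sqrt_continuous R _) (cvg_dot fx fx)).
Qed.

Lemma cvg_to_enorm (T : Type) (F : set_system T) {FF : Filter F}
    (f : T -> 'rV[R]_n) (e : T -> R) x :
  e @ F --> (0 : R) -> (forall k, enorm (f k - x) <= e k) -> f @ F --> x.
Proof.
move=> e0 fe; apply/cvgrPdist_le => r r0.
have /cvgrPdist_le/(_ r r0) := e0; apply: filterS => k.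
rewrite sub0r normrN => ek; rewrite distrC (le_trans (norm_le_enorm _))//.
by rewrite (le_trans (fe k))// (le_trans (ler_norm _)).
Qed.

Lemma lim_le_cst (u : nat -> R) l c :
  u @ \oo --> l -> (forall k, u k <= c) -> l <= c.
Proof.
by move=> ul uc; apply: (cvgr_to_le ul); exact: nearW.
Qed.

Lemma closureP A x :
  closure A x <->
  exists2 u : nat -> 'rV[R]_n, (forall k, A (u k)) & u @ \oo --> x.
Proof.
split=> [Ax|[u Au ux]]; last first.
  apply: (closed_cvg _ (@closed_closure _ A) _ x ux).
  by apply: nearW => k; exact: subset_closure.
have ex k : exists y, A y /\ `|y - x| < k.+1%:R^-1.
  have [|y [Ay]] := Ax (ball x k.+1%:R^-1).
    by apply: nbhsx_ballx; rewrite invr_gt0.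
  by rewrite -ball_normE /= distrC => xy; exists y.
have [u Hu] := choice ex; exists u => [k|]; first by case: (Hu k).
apply/cvgrPdist_le => r r0; near=> k.
rewrite distrC (le_trans (ltW (Hu k).2))// ltW//; near: k.
exact: (near_infty_natSinv_lt (PosNum r0)).
Unshelve. all: by end_near. Qed.

Lemma closure_enorm A x e : closure A x -> 0 < e ->
  exists2 u, A u & enorm (u - x) <= e.
Proof.
move=> /closureP[u Au ux] e0.
have ux0 : (fun k => enorm (u k - x)) @ \oo --> (0 : R).
  by rewrite -enorm0 -(subrr x); apply: cvg_enorm; exact: (cvgB ux (cvg_cst x)).
have [k uk] := @filter_ex _ \oo _ _ (cvgr_le _ ux0 _ e0).
by exists (u k).
Qed.

Lemma sup_enorm_closure A :
  ereal_sup [set (enorm v)%:E | v in closure A] =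
  ereal_sup [set (enorm v)%:E | v in A].
Proof.
apply/eqP; rewrite eq_le; apply/andP; split; last first.
  by apply: le_ereal_sup => _ [v Av <-]; exists v => //; exact: subset_closure.
apply: ge_ereal_sup => _ [v Av <-]; apply/lee_addgt0Pr => e e0.
have [u Au uv] := closure_enorm Av e0.
apply: (@le_trans _ _ ((enorm u)%:E + e%:E)%E).
  rewrite -EFinD lee_fin -[X in enorm X](subrKC u) (le_trans (ler_enormD _ _))//.
  by rewrite lerD2l enormB.
by rewrite leeD2r//; apply: ereal_sup_ubound; exists u.
Qed.

Lemma nbhs00_enorm (P : set ('rV[R]_n * 'rV[R]_n)) :
  nbhs ((0 : 'rV[R]_n), (0 : 'rV[R]_n)) P ->
  exists2 e : R, 0 < e & forall a b, enorm a < e -> enorm b < e -> P (a, b).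
Proof.
move=> /nbhs_ballP[e /= e0 eP]; exists e => // a b ae be; apply: eP.
by split; rewrite -ball_normE /= sub0r normrN (le_lt_trans (norm_le_enorm _)).
Qed.

Lemma exists_scale x y (e : R) : 0 < e -> exists2 t : R, 0 < t &
  enorm (t *: x) < e /\ enorm (t *: y) < e.
Proof.
move=> e0; have d0 : 0 < 1 + enorm x + enorm y.
  by rewrite -addrA ltr_wpDr// addr_ge0// enorm_ge0.
exists (e / (1 + enorm x + enorm y)); first exact: divr_gt0.
have hx := enorm_ge0 x; have hy := enorm_ge0 y.
rewrite !enormZ gtr0_norm ?divr_gt0//.
by split; rewrite mulrAC ltr_pdivrMr// ltr_pM2l//; lra.
Qed.

End Euclidean.

(** * Projections, faces and polar cones *)

Section Projection.
Context {R : realType} {n : nat}.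
Implicit Types (x y z u v w p : 'rV[R]_n) (A B C K : set 'rV[R]_n) (s t c : R).

Lemma convex_setE A : @convex_set R 'rV[R]_n A ->
  forall x y t, A x -> A y -> 0 <= t -> t <= 1 -> A (t *: x + (1 - t) *: y).
Proof.
move=> cA x y t Ax Ay t0 t1.
by have := cA x y (Itv01 t0 t1); rewrite !inE => /(_ Ax Ay).
Qed.

Lemma bounded_setP A :
  bounded_set A <-> exists M, forall x, A x -> enorm x <= M.
Proof.
split=> [[M [_ AM]]|[M AM]].
  exists (Num.sqrt n%:R * (M + 1)) => x Ax.
  rewrite (le_trans (enorm_le_norm x))// ler_wpM2l ?sqrtr_ge0//.
  by apply: (AM (M + 1)) => //; rewrite ltrDl.
exists M; split=> [|N MN x Ax]; first exact: num_real.
by rewrite /= (le_trans (norm_le_enorm x))// (le_trans (AM _ Ax))// ltW.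
Qed.

Lemma proj_nonempty A x : closed A -> A !=set0 -> proj A x !=set0.
Proof.
move=> cA [a Aa].
pose B := A `&` [set y | enorm (y - x) <= enorm (a - x)].
have cf : continuous (fun y => enorm (y - x)).
  by move=> y; exact: (cvg_enorm (cvgB (@cvg_id _ (nbhs y)) (cvg_cst x))).
have cB : compact B.
  apply: bounded_closed_compact.
    apply/bounded_setP; exists (enorm (a - x) + enorm x) => y [_ /= yx].
    by rewrite -{1}(subrK x y) (le_trans (ler_enormD _ _))// lerD2r.
  apply: closedI => //.
  exact: (proj1 (continuous_closedP _) cf _ (@closed_le _ (enorm (a - x)))).
have [|p /set_mem[Ap pa] pmin] := compact_EVT_min _ cB (continuous_subspaceT cf).
  by exists a; split => /=.
exists p; split=> // z Az.
have [za|/ltW az] := leP (enorm (z - x)) (enorm (a - x)).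
  by apply: pmin; rewrite inE.
exact: le_trans pa az.
Qed.

(** Obtuse angle at the projection.  Otherwise a short step from [p] towards [z]
    would come closer to [x]. *)
Lemma proj_dot_le0 A x p z : @convex_set R 'rV[R]_n A ->
  proj A x p -> A z -> dot (x - p) (z - p) <= 0.
Proof.
move=> /convex_setE cA [Ap pmin] Az; rewrite leNgt; apply/negP => c0.
set c := dot (x - p) (z - p) in c0; pose q := dot (z - p) (z - p).
have q0 : 0 <= q := dot_ge0 _.
have cq : 0 < c + q by rewrite ltr_wpDr.
(* This step makes [t * (c + q) = c], so the gain [2 t c] beats the loss
   [t ^ 2 q]. *)
pose t := c / (c + q).
have t0 : 0 < t by rewrite divr_gt0.
have t1 : t <= 1 by rewrite ler_pdivrMr// mul1r lerDl.
have := pmin _ (cA _ _ t Az Ap (ltW t0) t1).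
rewrite (_ : _ + _ - x = t *: (z - p) - (x - p)); last first.
  by rewrite scalerBr scalerBl scale1r; apply/rowP => i; rewrite !mxE; ring.
rewrite ler_enorm.
have -> : dot (p - x) (p - x) = dot (x - p) (x - p).
  by rewrite -opprB dotNl dotNr opprK.
rewrite !(dotBl (t *: _)) !(dotBr (t *: _)) !dotZl !dotZr.
rewrite (dotC (z - p) (x - p)) -/c -/q.
have tq : t * (c + q) = c by rewrite divfK ?gt_eqF.
nra.
Qed.

(** Used to exhibit horizon directions: the points of the ray are scaled by
    1/(k+1). *)
Lemma horizon_cone_ray (A : set 'rV[R]_n) v w :
  (forall k, A (v + k.+1%:R *: w)) -> horizon_cone A w.
Proof.
move=> Avw; exists (fun k => v + k.+1%:R *: w), (fun k => k.+1%:R^-1).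
split=> //; first exact: cvg_harmonic.
rewrite (_ : (fun k => _) = (fun k => k.+1%:R^-1 *: v + w)).
  rewrite -[X in _ --> X]add0r; apply: cvgD; last exact: cvg_cst.
  by rewrite -[X in _ --> X](scale0r v); apply: cvgZl; exact: cvg_harmonic.
by apply/funext => k; rewrite scalerDr scalerA mulVf ?scale1r.
Qed.

Lemma faceZ C x t :
  0 < t -> face C (t *: x) = face C x.
Proof.
move=> t0; apply/seteqP; split=> v [Cv vmax]; split=> // u /vmax.
  by rewrite !dotZr ler_pM2l.
by rewrite !dotZr ler_pM2l.
Qed.

(** Separation: the difference between a point and its projection on [A] is the
    normal of a half-space that contains [A] but not the point. *)
Lemma closed_convex_sep A v : closed A -> @convex_set R 'rV[R]_n A -> A !=set0 ->
  (forall x c, (forall u, A u -> dot u x <= c) -> dot v x <= c) -> A v.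
Proof.
move=> cA xA A0 /= h; have [p pp] := proj_nonempty v cA A0.
suff -> : v = p by case: pp.
apply/eqP; rewrite -subr_eq0 -dot_eq0 eq_le dot_ge0 andbT dotBl subr_le0.
apply: h => u Au; have := proj_dot_le0 xA pp Au.
by rewrite dotBr subr_le0 !(dotC (v - p)).
Qed.

Definition convex_cone K := [/\ K 0, forall x y, K x -> K y -> K (x + y)
  & forall t x, 0 < t -> K x -> K (t *: x)].

Lemma convex_coneW K : convex_cone K -> @convex_set R 'rV[R]_n K.
Proof.
move=> [_ KD KZ]; apply/convex_setW => x y; rewrite !inE => Kx Ky t t0 t1.
by rewrite inE; apply: KD; apply: KZ => //; rewrite subr_gt0.
Qed.

Lemma polar_convex_cone A : convex_cone (polar_cone A).
Proof.
split=> [z _|x y Ax Ay z Az|t x t0 Ax z Az]; first by rewrite dot0l.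
  by rewrite dotDl; have := Ax _ Az; have := Ay _ Az; lra.
by rewrite dotZl pmulr_rle0// Ax.
Qed.

Lemma polar_closed A : closed (polar_cone A).
Proof.
move=> x /closureP[u Au ux] z Az.
by apply: (lim_le_cst (cvg_dot ux (cvg_cst z))) => k; exact: Au.
Qed.

Lemma polarS A B : A `<=` B -> polar_cone B `<=` polar_cone A.
Proof. by move=> AB x Bx z /AB; exact: Bx. Qed.

Lemma sub_bipolar A : A `<=` polar_cone (polar_cone A).
Proof. by move=> x Ax z; rewrite dotC; exact. Qed.

Lemma tripolar A : polar_cone (polar_cone (polar_cone A)) = polar_cone A.
Proof.
by apply/seteqP; split; [exact/polarS/sub_bipolar|exact: sub_bipolar].
Qed.

Lemma closure_convex_cone K : convex_cone K -> convex_cone (closure K).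
Proof.
move=> [K0 KD KZ]; split; first exact: subset_closure.
- move=> x y /closureP[u Ku ux] /closureP[w Kw wy]; apply/closureP.
  by exists (fun k => u k + w k) => [k|]; [exact: KD|exact: cvgD].
- move=> t x t0 /closureP[u Ku ux]; apply/closureP.
  by exists (fun k => t *: u k) => [k|]; [exact: KZ|exact: cvgZr].
Qed.

Lemma proj_convex_cone K v p : convex_cone K -> proj K v p ->
  polar_cone K (v - p) /\ dot (v - p) p = 0.
Proof.
move=> cK pp; have [_ KD KZ] := cK; have Kp : K p by case: pp.
have h := fun z => @proj_dot_le0 K v p z (convex_coneW cK) pp.
split=> [z Kz|].
  by have := h _ (KD _ _ Kp Kz); rewrite addrAC subrr add0r.
apply/eqP; rewrite eq_le; apply/andP; split.
  have := h (2 *: p) (KZ _ _ _ Kp).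
  by rewrite -[X in 2 *: p - X]scale1r -scalerBl (_ : 2 - 1 = 1) ?scale1r; lra.
have := h (2^-1 *: p) (KZ _ _ _ Kp).
rewrite -[X in 2^-1 *: p - X]scale1r -scalerBl dotZr.
by move/(_ (ltac:(by rewrite invr_gt0))); lra.
Qed.

(** A point of the bipolar cone makes a nonpositive angle with its own residual
    after projection on the closure of [K], so this residual is zero. *)
Lemma bipolar K : convex_cone K -> polar_cone (polar_cone K) = closure K.
Proof.
move=> cK; apply/seteqP; split=> [w ww|]; last first.
  move=> w /closureP[u Ku uw] z pz.
  by apply: (lim_le_cst (cvg_dot uw (cvg_cst z))) => k; rewrite dotC; exact: pz.
have ccK := closure_convex_cone cK; have [K0 _ _] := ccK.
have [|p pp] := @proj_nonempty (closure K) w (@closed_closure _ _).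
  by exists 0.
have [/(polarS (@subset_closure _ _)) pw wp0] := proj_convex_cone ccK pp.
suff -> : w = p by case: pp.
apply/eqP; rewrite -subr_eq0 -dot_eq0 eq_le dot_ge0 andbT.
by rewrite dotBr wp0 subr0 dotC ww.
Qed.

(** Moreau's decomposition.  It makes the distance to [K] the norm of the
    projection on the polar cone, which links the excess of faces to the norms
    of the projectional subgradients. *)
Lemma moreau K v w : closed K -> convex_cone K -> proj (polar_cone K) v w ->
  [/\ polar_cone K w, K (v - w) & dot (v - w) w = 0].
Proof.
move=> clK cK pw; have [h1 h2] := proj_convex_cone (polar_convex_cone K) pw.
split=> //; first by case: pw.
by move: h1; rewrite bipolar// -(proj1 (closure_id _) clK).
Qed.

Lemma dist_convex_cone K v w : closed K -> convex_cone K ->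
  proj (polar_cone K) v w -> dist v K = (enorm w)%:E.
Proof.
move=> clK cK /(moreau clK cK)[pw Kvw vww]; apply/eqP; rewrite eq_le.
apply/andP; split.
  apply: ereal_inf_lbound; exists (v - w) => //.
  by rewrite addrAC subrr add0r enormN.
apply: le_ereal_inf_tmp => _ [z Kz <-]; rewrite lee_fin ler_enorm.
rewrite (_ : z - v = z - (v - w) - w); last first.
  by rewrite opprB addrCA addrAC subrr add0r.
have : dot (z - (v - w)) w <= 0 by rewrite dotBl vww subr0 dotC pw.
move: (z - (v - w)) => a aw.
by rewrite dotBl !dotBr (dotC w a); have := dot_ge0 a; lra.
Qed.

End Projection.

(** * Finitely generated cones *)

Section FiniteCones.
Context {R : realType} {n : nat}.
Implicit Types (x y z u v w a b : 'rV[R]_n) (s t c e : R).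
Implicit Types (B W : seq 'rV[R]_n).

(** Defined by recursion on the generators, so that they can be eliminated one
    by one. *)
Fixpoint gcone W : set 'rV[R]_n :=
  if W is w :: W' then [set x | exists2 t : R, 0 <= t & gcone W' (x - t *: w)]
  else [set 0].

Definition hcone B : set 'rV[R]_n := [set x | forall b, b \in B -> dot b x <= 0].

Lemma gcone0 W : gcone W 0.
Proof. by elim: W => //= w W IH; exists 0 => //; rewrite scale0r subr0. Qed.

(** A nonnegative combination of [W] is tested against a vector by testing the
    generators, so duality turns generators into normals. *)
Lemma polar_gcone W : polar_cone (gcone W) = hcone W.
Proof.
elim: W => [|w W IH] /=.
  apply/seteqP; split=> x; first by move=> _ b.
  by move=> _ z ->; rewrite dot0r.
apply/seteqP; split=> [x xW b|x xW z [t t0 /= zW]].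
  rewrite inE => /predU1P[->|].
    rewrite dotC; apply: xW; exists 1 => //=; rewrite scale1r subrr.
    exact: gcone0.
  suff : hcone W x by apply.
  by rewrite -IH => z zW; apply: xW; exists 0 => //=; rewrite scale0r subr0.
have : polar_cone (gcone W) x.
  by rewrite IH => b bW; apply: xW; rewrite inE bW orbT.
move=> /(_ _ zW); rewrite dotBr dotZr (dotC x w).
have := xW w (mem_head _ _); nra.
Qed.

(** Eliminating [t >= 0] from [dot b x <= t * dot b w]: a normal with
    [dot b w <= 0] survives as it is, and a lower bound on [t], which comes from
    a normal with [0 < dot b w], is combined with each upper bound. *)
Lemma hcone_add_ray B w : exists B',
  [set x | exists2 t : R, 0 <= t & hcone B (x - t *: w)] = hcone B'.
Proof.
pose lo := [seq b <- B | 0 < dot b w].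
pose up := [seq b <- B | dot b w < 0].
exists ([seq b <- B | dot b w <= 0] ++
  [seq - dot u w *: l + dot l w *: u | l <- lo, u <- up]).
apply/seteqP; split=> [x [t t0 xt] b|x xB].
  rewrite mem_cat mem_filter => /orP[/andP[bw bB]|/allpairsP[[l u] /= [+ + ->]]].
    by have := xt _ bB; rewrite dotBr dotZr; nra.
  rewrite !mem_filter => /andP[l0 lB] /andP[u0 uB].
  have := xt _ lB; have := xt _ uB; rewrite !dotE.
  nra.
have hu u : u \in B -> dot u w < 0 -> dot u x <= 0.
  by move=> uB uw; apply: xB; rewrite mem_cat mem_filter uB ltW.
have hlu l u : l \in B -> u \in B -> 0 < dot l w -> dot u w < 0 ->
    dot l x / dot l w <= dot u x / dot u w.
  move=> lB uB lw uw.
  have : dot (- dot u w *: l + dot l w *: u) x <= 0.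
    apply: xB; rewrite mem_cat; apply/orP; right; apply/allpairsP.
    by exists (l, u); rewrite !mem_filter lw uw lB uB.
  rewrite !dotE ler_pdivrMr// mulrAC ler_ndivlMr//; lra.
(* The largest of the lower bounds, among which is 0. *)
pose t := \big[Num.max/0]_(l <- lo) (dot l x / dot l w).
exists t; first exact: bigmax_ge_id.
move=> b bB; rewrite dotBr dotZr; case: (ltgtP (dot b w) 0) => bw.
- rewrite subr_le0 -ler_ndivlMr// /t big_seq; apply: bigmax_le.
    by have := hu _ bB bw; rewrite ler_ndivlMr// mul0r.
  by move=> l; rewrite mem_filter => /andP[lw lB]; exact: hlu.
- rewrite subr_le0 -ler_pdivrMr//.
  apply: (le_bigmax_seq 0 b xpredT (fun l => dot l x / dot l w)) => //.
  by rewrite mem_filter bw.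
- rewrite bw mulr0 subr0; apply: xB.
  by rewrite mem_cat mem_filter bB bw lexx.
Qed.

(** Weyl's theorem, one generator at a time. *)
Lemma gcone_hcone W : exists B, gcone W = hcone B.
Proof.
elim: W => [|w W [B IH]] /=; last first.
  by rewrite IH; exact: hcone_add_ray.
exists ([seq delta_mx 0 i | i <- enum 'I_n] ++
  [seq - delta_mx 0 i | i <- enum 'I_n]).
apply/seteqP; split=> x /=; first by move=> -> b _; rewrite dot0r.
move=> xB; apply/rowP => i; rewrite mxE.
have dx : dot (delta_mx 0 i) x = x 0 i.
  rewrite /dot (bigD1 i)//= mxE !eqxx mul1r big1 ?addr0// => j /negPf ji.
  by rewrite mxE eqxx ji mul0r.
apply/eqP; rewrite eq_le -dx; apply/andP; split.
  by apply: xB; rewrite mem_cat; apply/orP; left; rewrite map_f ?mem_enum.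
rewrite -oppr_le0 -dotNl.
apply: xB; rewrite mem_cat; apply/orP; right.
by rewrite (map_f (fun i => - delta_mx 0 i)) ?mem_enum.
Qed.

(** Minkowski's theorem: Weyl's theorem for the polar cone, dualised. *)
Lemma hcone_gcone B : exists W, hcone B = gcone W.
Proof.
have [W BW] := gcone_hcone B; exists W; have [B' WB'] := gcone_hcone W.
by rewrite -polar_gcone BW -polar_gcone WB' -polar_gcone tripolar.
Qed.

Lemma gcone_halfspace W u :
  (forall w, w \in W -> dot u w <= 0) -> forall x, gcone W x -> dot u x <= 0.
Proof.
move=> uW; have : polar_cone (gcone W) u.
  by rewrite polar_gcone => w /uW; rewrite dotC.
by [].
Qed.

Lemma gcone_mem W w : w \in W -> gcone W w.
Proof.
elim: W => //= v W IH; rewrite inE => /predU1P[->|/IH wW].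
  by exists 1 => //; rewrite scale1r subrr; exact: gcone0.
by exists 0 => //; rewrite scale0r subr0.
Qed.

End FiniteCones.

(** * Polyhedra *)

Section Polyhedra.
Context {R : realType} {n : nat}.
Implicit Types (x y u v a : 'rV[R]_n) (t c e : R).
Implicit Types (C : set 'rV[R]_n) (P Q : seq 'rV[R]_n).

Definition ineqs (s : seq ('rV[R]_n * R)) : set 'rV[R]_n :=
  [set v | forall p, p \in s -> dot p.1 v <= p.2].

Lemma polyhedralP C : polyhedral C <-> exists s, C = ineqs s.
Proof.
split=> [[m [a [b ->]]]|[s ->]].
  exists [seq (a i, b i) | i <- enum 'I_m].
  apply/seteqP; split=> v /= vab; first by move=> _ /mapP[i _ ->]; exact: vab.
  by move=> i; apply: (vab (a i, b i)); apply/mapP; exists i; rewrite ?mem_enum.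
exists (size s), (fun i => (nth (0, 0) s i).1), (fun i => (nth (0, 0) s i).2).
apply/seteqP; split=> v /= vs => [i|p ps]; first by apply: vs; exact: mem_nth.
have := ps; rewrite -index_mem => i.
by have := vs (Ordinal i); rewrite nth_index.
Qed.

Lemma polyhedral_forall m (C : 'I_m -> set 'rV[R]_n) :
  (forall i, polyhedral (C i)) -> polyhedral [set v | forall i, C i v].
Proof.
move=> pC; have /choice[s_ sC] : forall i, exists s, C i = ineqs s.
  by move=> i; apply/polyhedralP.
apply/polyhedralP; exists (flatten [seq s_ i | i <- enum 'I_m]).
apply/seteqP; split=> v /= vC => [p /flatten_mapP[i _ pi]|i].
  by have := vC i; rewrite sC; apply.
rewrite sC => p pi; apply: vC; apply/flatten_mapP; exists i => //.
by rewrite mem_enum.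
Qed.

(* Homogenisation: [v] is embedded at height [t] in one more dimension. *)
Let hom (t : R) v : 'rV[R]_(1 + n) := row_mx t%:M v.
Let hd (z : 'rV[R]_(1 + n)) : R := lsubmx z 0 0.
Let tl (z : 'rV[R]_(1 + n)) : 'rV[R]_n := rsubmx z.

Let dot_hom t v z : dot (hom t v) z = t * hd z + dot v (tl z).
Proof.
rewrite -{1}[z]hsubmxK /dot big_split_ord big_ord1 /hom/= !row_mxEl.
by rewrite mxE mulr1n; congr (_ + _); apply: eq_bigr => i _; rewrite !row_mxEr.
Qed.

Let hd_hom t v : hd (hom t v) = t.
Proof. by rewrite /hd row_mxKl mxE mulr1n. Qed.

Let tl_hom t v : tl (hom t v) = v.
Proof. by rewrite /tl row_mxKr. Qed.

(** Minkowski's theorem for polyhedra, in terms of linear inequalities: [P] and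
    [Q] are the points and the directions of a representation
    conv P + cone Q of [C].  The generators of the homogenised cone over [C]
    with positive first coordinate yield the points, the others the
    directions. *)
Lemma polyhedral_generators C : polyhedral C -> exists P Q,
  [/\ forall p, p \in P -> C p,
      forall v q t, C v -> q \in Q -> 0 <= t -> C (v + t *: q)
    & forall u c, (forall p, p \in P -> dot u p <= c) ->
        (forall q, q \in Q -> dot u q <= 0) -> forall v, C v -> dot u v <= c].
Proof.
move=> /polyhedralP[s ->].
(* The first normal says that the height is nonnegative. *)
pose B := hom (- 1) 0 :: [seq hom (- p.2) p.1 | p <- s].
have [W BW] := hcone_gcone B.
have hdW w : w \in W -> 0 <= hd w.
  move=> /gcone_mem; rewrite -BW => /(_ _ (mem_head _ _)).
  by rewrite dot_hom dot0l addr0 mulN1r oppr_le0.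
have tlW w p : w \in W -> p \in s -> dot p.1 (tl w) <= p.2 * hd w.
  move=> /gcone_mem; rewrite -BW => + ps => /(_ (hom (- p.2) p.1)).
  rewrite inE dot_hom mulNr addrC subr_le0; apply.
  by apply/orP; right; apply/mapP; exists p.
exists [seq (hd w)^-1 *: tl w | w <- W & 0 < hd w],
  [seq tl w | w <- W & hd w == 0].
split.
- move=> _ /mapP[w + ->] p ps; rewrite mem_filter => /andP[w0 wW].
  by rewrite dotZr ler_pdivrMl// mulrC tlW.
- move=> v _ t vs /mapP[w + ->] t0 p ps.
  rewrite mem_filter => /andP[/eqP w0 wW]; rewrite dotDr dotZr.
  by have := vs _ ps; have := tlW _ _ wW ps; rewrite w0 mulr0; nra.
move=> u c uP uQ v vs.
have : dot (hom (- c) u) (hom 1 v) <= 0; last first.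
  by rewrite dot_hom hd_hom tl_hom mulr1 addrC subr_le0.
apply: (@gcone_halfspace _ _ W) => [w wW|].
  rewrite dot_hom mulNr addrC subr_le0.
  have := hdW _ wW; rewrite le_eqVlt => /predU1P[w0|w0].
    by rewrite -w0 mulr0; apply: uQ; apply: map_f; rewrite mem_filter -w0 eqxx.
  have /uP : (hd w)^-1 *: tl w \in [seq (hd w)^-1 *: tl w | w <- W & 0 < hd w].
    by apply/mapP; exists w => //; rewrite mem_filter w0.
  by rewrite dotZr ler_pdivrMl// mulrC.
rewrite -BW => b; rewrite inE => /predU1P[->|/mapP[p ps ->]].
  by rewrite dot_hom hd_hom dot0l; lra.
by rewrite dot_hom hd_hom tl_hom; have := vs _ ps; lra.
Qed.

(** The inequality holds for all points of [C] as soon as it holds at the points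
    [P] and, in its homogeneous form, along the directions [Q] that generate
    [C]. *)
Lemma polyhedral_dual C a c : polyhedral C ->
  polyhedral [set u | forall x, C x -> dot u x <= dot a x + c].
Proof.
move=> pC; have [C0|C0] := pselect (C !=set0); last first.
  apply/polyhedralP; exists [::]; apply/seteqP; split=> // v _ x Cx.
  by case: C0; exists x.
have [P [Q [CP CQ CPQ]]] := polyhedral_generators pC.
apply/polyhedralP.
exists ([seq (p, dot a p + c) | p <- P] ++ [seq (q, dot a q) | q <- Q]).
apply/seteqP; split=> u uC.
  move=> _ /[!mem_cat] /orP[/mapP[p pP ->]|/mapP[q qQ ->]] /=.
    by rewrite dotC; apply: uC; exact: CP.
  have [v Cv] := C0; apply/ler_addgt0Pr => e e0.
  (* A large multiple of the direction [q] outweighs the base point [v]. *)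
  pose g := dot a v + c - dot u v; have g0 : 0 <= g by rewrite subr_ge0 uC.
  have eg : 0 <= g / e by rewrite divr_ge0// ltW.
  have := uC _ (CQ v q (g / e + 1) Cv qQ (ltac:(lra))).
  rewrite !dotDr !dotZr (dotC q) => h1.
  have : (g / e + 1) * (dot u q - dot a q) <= g by rewrite /g in h1 *; lra.
  have ge : g / e * e = g by rewrite divfK// gt_eqF.
  by move: (g / e) eg ge => r eg ge h2; rewrite leNgt; apply/negP => h3; nra.
move=> x Cx; rewrite addrC -lerBlDr -dotBl; apply: (CPQ _ _ _ _ _ Cx) => [p pP|q qQ].
  have /= := uC (p, dot a p + c).
  rewrite mem_cat (map_f (fun p => (p, dot a p + c)))//.
  by move=> /(_ isT); rewrite dotBl (dotC p); lra.
have /= := uC (q, dot a q).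
rewrite mem_cat (map_f (fun q => (q, dot a q)) qQ) orbT.
by move=> /(_ isT); rewrite dotBl (dotC q); lra.
Qed.

End Polyhedra.

(** * Relative interior of a convex cone *)

Section RelativeInterior.
Context {R : realType} {n : nat}.
Implicit Types (x y z u v w a b : 'rV[R]_n) (s t c e : R).

Lemma dot_mulmx x y : dot x y = (x *m y^T) ord0 ord0.
Proof. by rewrite mxE; apply: eq_bigr => i _; rewrite mxE. Qed.

Lemma ler_enorm_sum I (r : seq I) (F : I -> 'rV[R]_n) :
  enorm (\sum_(i <- r) F i) <= \sum_(i <- r) enorm (F i).
Proof.
elim/big_ind2 : _ => // [|u s v t us vt]; first by rewrite enorm0.
by rewrite (le_trans (ler_enormD _ _))// lerD.
Qed.

Lemma ler_norm_between (p q d : R) : p <= d -> d <= q -> `|d| <= `|p| + `|q|.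
Proof.
move=> pd dq; rewrite ler_norml; apply/andP; split.
  by have := lerNnormlW (lexx `|p|); have := normr_ge0 q; lra.
by have := ler_norm q; have := normr_ge0 p; lra.
Qed.

(** The rows form a tuple of elements of [S] of maximal rank: a point of [S]
    outside their span could be appended to them. *)
Lemma exists_spanning_matrix (S : set 'rV[R]_n) :
  exists m (A : 'M[R]_(m, n)),
    (forall i, S (row i A)) /\ forall a, S a -> (a <= A)%MS.
Proof.
pose P r := `[< exists m (A : 'M[R]_(m, n)),
  (forall i, S (row i A)) /\ \rank A = r >].
have P0 : exists r, P r.
  exists 0%N; apply/asboolP; exists 0%N, 0; split; last by rewrite mxrank0.
  by case.
have Pn r : P r -> (r <= n)%N.
  by move=> /asboolP[m [A [_ <-]]]; exact: rank_leq_col.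
case: (ex_maxnP P0 Pn) => r /asboolP[m [A [SA rA]]] rmax.
exists m, A; split=> // a Sa.
have Aa : (A <= col_mx A a)%MS by rewrite -addsmxE addsmxSl.
have : (col_mx A a <= A)%MS.
  rewrite -(geq_leqif (mxrank_leqif_sup Aa)) rA; apply: rmax; apply/asboolP.
  exists (m + 1)%N, (col_mx A a); split=> // i.
  by case: (split_ordP i) => j ->; rewrite ?rowKu// rowKd row_id.
by rewrite col_mx_sub => /andP[].
Qed.

Lemma convex_cone_sum m (S : set 'rV[R]_n) (F : 'I_m -> 'rV[R]_n)
  (c : 'I_m -> R) : convex_cone S -> (forall i, S (F i)) ->
  (forall i, 0 < c i) -> S (\sum_i c i *: F i).
Proof.
move=> [S0 SD SZ] SF c0; elim/big_ind : _ => // i _; exact: SZ.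
Qed.

(** For a convex cone [S] these are the points of the relative interior,
    described without reference to the linear span of [S]. *)
Definition is_core (S : set 'rV[R]_n) y :=
  forall a, S a -> exists2 e : R, 0 < e & S (y - e *: a).

(** The sum of a spanning family from [S] will do: subtracting a small multiple
    of any combination of the family leaves all coefficients positive. *)
Lemma exists_core (S : set 'rV[R]_n) : convex_cone S ->
  exists2 x0, S x0 & is_core S x0.
Proof.
move=> cS; have [m [A [SA spanA]]] := exists_spanning_matrix S.
exists (\sum_i (1 : R) *: row i A); first exact: convex_cone_sum.
move=> a /spanA/submxP[c ->]; rewrite mulmx_sum_row.
pose d := 1 + \sum_i `|c ord0 i|.
have s0 : 0 <= \sum_i `|c ord0 i| by exact: sumr_ge0.
have d0 : 0 < d by rewrite ltr_wpDr.
exists d^-1; first by rewrite invr_gt0.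
rewrite scaler_sumr -sumrB.
under eq_bigr do rewrite scalerA -scalerBl.
apply: convex_cone_sum => // i; rewrite subr_gt0 mulrC ltr_pdivrMr// mul1r.
rewrite (le_lt_trans (ler_norm _))// /d (bigD1 i)//=.
by rewrite addrCA ltrDl ltr_wpDr// sumr_ge0.
Qed.

Lemma core_add (S : set 'rV[R]_n) a x0 t : convex_cone S -> S a ->
  is_core S x0 -> 0 < t -> is_core S (a + t *: x0).
Proof.
move=> [_ SD SZ] Sa x0S t0 b /x0S[e e0 Sx]; exists (t * e); first exact: mulr_gt0.
by rewrite -addrA -scalerA -scalerBr; apply: SD => //; exact: SZ.
Qed.

End RelativeInterior.

(** * Support functions, their domain and the faces of [D] *)

Section SupportFunction.
Context {R : realType} {n : nat}.
Context (D : set 'rV[R]_n) (D_closed : closed D).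
Context (D_convex : @convex_set R 'rV[R]_n D) (D_neq0 : D !=set0).
Implicit Types (x y z u v w p a b : 'rV[R]_n) (s t c e L : R).

Local Notation h := (support_fun D).
Local Notation X := (effdom h).
Local Notation Dinf := (horizon_cone D).

Definition sfun x : R := fine (h x).

Lemma effdomP x : X x <-> exists c, forall v, D v -> dot v x <= c.
Proof.
split=> [xX|[c Dc]]; last first.
  apply: (@le_lt_trans _ _ c%:E); last exact: ltry.
  by apply: ge_ereal_sup => _ [v Dv <-]; rewrite lee_fin Dc.
have [v0 Dv0] := D_neq0; have fx : h x \is a fin_num.
  rewrite fin_real//; apply/andP; split; last exact: xX.
  apply: (@lt_le_trans _ _ (dot v0 x)%:E); first exact: ltNyr.
  by apply: ereal_sup_ubound; exists v0.
exists (sfun x) => v Dv; rewrite -lee_fin fineK//.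
by apply: ereal_sup_ubound; exists v.
Qed.

Lemma sfunE x : X x -> h x = (sfun x)%:E.
Proof.
move=> xX; rewrite fineK// fin_real//; apply/andP; split; last exact: xX.
have [v0 Dv0] := D_neq0.
apply: (@lt_le_trans _ _ (dot v0 x)%:E); first exact: ltNyr.
by apply: ereal_sup_ubound; exists v0.
Qed.

Lemma sfun_ge x v : X x -> D v -> dot v x <= sfun x.
Proof.
by move=> xX Dv; rewrite -lee_fin -sfunE//; apply: ereal_sup_ubound; exists v.
Qed.

Lemma sfun_le x c : (forall v, D v -> dot v x <= c) -> sfun x <= c.
Proof.
move=> Dc; have xX : X x by apply/effdomP; exists c.
rewrite -lee_fin -sfunE//.
by apply: ge_ereal_sup => _ [v Dv <-]; rewrite lee_fin Dc.
Qed.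

Lemma effdom_convex_cone : convex_cone X.
Proof.
split=> [|x y /effdomP[c xc] /effdomP[d yd]|t x t0 /effdomP[c xc]].
- by apply/effdomP; exists 0 => v _; rewrite dot0r.
- by apply/effdomP; exists (c + d) => v Dv; rewrite dotDr lerD ?xc ?yd.
- by apply/effdomP; exists (t * c) => v Dv; rewrite dotZr ler_pM2l// xc.
Qed.

Let X0 : X 0. Proof. by have [] := effdom_convex_cone. Qed.
Let XD x y : X x -> X y -> X (x + y).
Proof. by have [_ + _] := effdom_convex_cone; apply. Qed.
Let XZ t x : 0 < t -> X x -> X (t *: x).
Proof. by have [_ _] := effdom_convex_cone; apply. Qed.

Lemma sfunD x y : X x -> X y -> sfun (x + y) <= sfun x + sfun y.
Proof.
by move=> xX yX; apply: sfun_le => v Dv; rewrite dotDr lerD ?sfun_ge.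
Qed.

Lemma sfunZ t x : 0 < t -> X x -> sfun (t *: x) = t * sfun x.
Proof.
move=> t0 xX; apply/eqP; rewrite eq_le; apply/andP; split.
  by apply: sfun_le => v Dv; rewrite dotZr ler_pM2l// sfun_ge.
rewrite -ler_pdivlMl//; apply: sfun_le => v Dv.
by rewrite ler_pdivlMl// -dotZr sfun_ge//; exact: XZ.
Qed.

(** Separation recovers the closed convex set [D] from [h], and only the values
    on the domain matter. *)
Lemma mem_support v : D v <-> forall x, X x -> dot v x <= sfun x.
Proof.
split=> [Dv x xX|vX]; first exact: sfun_ge.
apply: closed_convex_sep => // x c Dc.
have xX : X x by apply/effdomP; exists c.
by rewrite (le_trans (vX _ xX))// sfun_le.
Qed.

(** A ray stays in [D] exactly when no linear form that is bounded above on [D]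
    increases along it. *)
Lemma horizon_support : Dinf = polar_cone X.
Proof.
apply/seteqP; split=> [w [x_ [l_ [Dx l0 lc lx]]] x xX|w Xw].
  have h1 : (fun k => dot (l_ k *: x_ k) x) @ \oo --> dot w x.
    exact: (cvg_dot lx (cvg_cst x)).
  have h2 : (fun k => l_ k * sfun x) @ \oo --> (0 : R).
    by rewrite -[X in _ --> X](mul0r (sfun x)); apply: cvgMl.
  apply: (ler_cvg_to h1 h2); apply: nearW => k.
  by rewrite dotZl ler_pM2l// sfun_ge.
have [v Dv] := D_neq0; apply: (@horizon_cone_ray _ _ _ v) => k.
apply/mem_support => x xX; rewrite dotDl dotZl.
have := sfun_ge xX Dv; have := Xw _ xX.
have : 0 < k.+1%:R :> R by []. nra.
Qed.

Lemma horizon_convex_cone : convex_cone Dinf.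
Proof. by rewrite horizon_support; exact: polar_convex_cone. Qed.

Lemma horizon_closed : closed Dinf.
Proof. by rewrite horizon_support; exact: polar_closed. Qed.

Lemma support_add_horizon v w : D v -> Dinf w -> D (v + w).
Proof.
rewrite horizon_support => Dv Xw; apply/mem_support => x xX; rewrite dotDl.
by have := sfun_ge xX Dv; have := Xw _ xX; lra.
Qed.

Lemma sub_effdom_polar : X `<=` polar_cone Dinf.
Proof. by rewrite horizon_support; exact: sub_bipolar. Qed.

Lemma faceP x v : face D x v <-> [/\ D v, X x & dot v x = sfun x].
Proof.
split=> [[Dv vmax]|[Dv xX vx]]; last first.
  by split=> // u Du; rewrite vx sfun_ge.
have xX : X x by apply/effdomP; exists (dot v x).
by split=> //; apply/eqP; rewrite eq_le sfun_ge// sfun_le.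
Qed.

Lemma face_horizonE x : polar_cone Dinf x ->
  face Dinf x = [set w | Dinf w /\ dot w x = 0].
Proof.
have [D0 _ _] := horizon_convex_cone.
move=> xD; apply/seteqP; split=> w [Dw].
  move=> /(_ 0 D0); rewrite dot0l => wx; split=> //; apply/eqP.
  by rewrite eq_le wx andbT dotC xD.
by move=> wx; split=> // u Du; rewrite wx dotC xD.
Qed.

Lemma face_horizon_convex_cone x :
  polar_cone Dinf x -> convex_cone (face Dinf x).
Proof.
have [D0 DD DZ] := horizon_convex_cone.
move=> xD; rewrite face_horizonE//; split=> /=.
- by rewrite dot0l.
- by move=> u w [Du ux] [Dw wx]; split; [exact: DD|rewrite dotDl ux wx addr0].
- by move=> t u t0 [Du ux]; split; [exact: DZ|rewrite dotZl ux mulr0].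
Qed.

Lemma face_horizon_closed x : polar_cone Dinf x -> closed (face Dinf x).
Proof.
move=> xD; rewrite face_horizonE// => w /closureP[u uD uw]; split.
  by apply: horizon_closed; apply/closureP; exists u => // k; case: (uD k).
apply: (cvg_unique _ (cvg_dot uw (cvg_cst x))) => //.
rewrite (_ : (fun k => _) = cst 0); first exact: cvg_cst.
by apply/funext => k; case: (uD k).
Qed.

Lemma face_horizon_nonempty x : polar_cone Dinf x -> face Dinf x !=set0.
Proof. by case/face_horizon_convex_cone => + _ _; exists 0. Qed.

Lemma face_add_horizon x v w :
  polar_cone Dinf x -> face D x v -> face Dinf x w -> face D x (v + w).
Proof.
move=> xD /faceP[Dv xX vx]; rewrite face_horizonE// => -[Dw wx].
by apply/faceP; split=> //; [exact: support_add_horizon|rewrite dotDl wx addr0].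
Qed.

Lemma horizon_face x : polar_cone Dinf x -> face D x !=set0 ->
  horizon_cone (face D x) = face Dinf x.
Proof.
move=> xD [v xv]; have [_ _ FZ] := face_horizon_convex_cone xD.
apply/seteqP; split=> [w [x_ [l_ [Fx l0 lc lx]]]|w Fw]; last first.
  apply: (@horizon_cone_ray _ _ _ v) => k; apply: face_add_horizon => //.
  exact: FZ.
rewrite face_horizonE//; split.
  by exists x_, l_; split=> // k; case: (Fx k).
have h1 : (fun k => dot (l_ k *: x_ k) x) @ \oo --> dot w x.
  exact: (cvg_dot lx (cvg_cst x)).
suff h2 : (fun k => dot (l_ k *: x_ k) x) @ \oo --> (0 : R).
  exact: (cvg_unique _ h1 h2).
rewrite (_ : (fun k => _) = (fun k => l_ k * sfun x)).
  by rewrite -[X in _ --> X](mul0r (sfun x)); apply: cvgMl.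
by apply/funext => k; rewrite dotZl; have /faceP[_ _ ->] := Fx k.
Qed.

(** * Projectional subgradients at the origin *)

(** The bipolar theorem for the cone generated by [X] and [- x]: its polar is
    the normal cone of [X] at [x], that is [face Dinf x], and the tangent cone
    contains its closure. *)
Lemma tangent_effdom x : X x -> tangent_cone X x = polar_cone (face Dinf x).
Proof.
move=> xX; have xD : polar_cone Dinf x by exact: sub_effdom_polar.
rewrite face_horizonE// horizon_support//.
apply/seteqP; split=> [w [t_ [w_ [t0 tc wc Xw]]] z [zX zx]|w ww].
  apply: (lim_le_cst (cvg_dot wc (cvg_cst z))) => k.
  have := zX _ (Xw k); rewrite dotDr zx add0r dotZr pmulr_rle0//.
  by rewrite dotC.
pose K := [set y | exists u s, [/\ X u, 0 <= s & y = u - s *: x]].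
have cK : convex_cone K.
  split.
  - by exists 0, 0; rewrite scale0r subr0.
  - move=> _ _ [u [s [uX s0 ->]]] [v [t [vX t0 ->]]].
    exists (u + v), (s + t); split; [exact: XD|exact: addr_ge0|].
    by rewrite scalerDl opprD addrACA.
  - move=> c _ c0 [u [s [uX s0 ->]]].
    exists (c *: u), (c * s); split; [exact: XZ|by rewrite mulr_ge0// ltW|].
    by rewrite scalerBr scalerA.
have : polar_cone (polar_cone K) w.
  apply: (polarS _ ww) => z Kz.
  have zX : polar_cone X z.
    move=> u uX; apply: Kz; exists u, 0; split=> //.
    by rewrite scale0r subr0.
  split=> //; apply/eqP; rewrite eq_le (zX _ xX)/=.
  have /Kz : K (- x) by exists 0, 1; rewrite scale1r sub0r.
  by rewrite dotNr oppr_le0.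
rewrite bipolar// => /closureP[y_ Ky yw].
have [u_ Hu] := choice Ky; have [s_ Hs] := choice Hu.
(* The step is short enough for [x + t_k y_k = (1 - t_k s_k) x + t_k u_k] to
   be a positive combination. *)
pose t_ k := (k.+1%:R + s_ k)^-1.
have s0 k : 0 <= s_ k by case: (Hs k).
have t0 k : 0 < t_ k by rewrite invr_gt0 ltr_wpDr.
exists t_, y_; split=> // [|k].
  apply: (squeeze_cvgr _ (cvg_cst 0) (@cvg_harmonic R)).
  apply: nearW => k /=; rewrite ltW//=.
  by rewrite lef_pV2 ?posrE ?ltr_wpDr// lerDl.
have [uX _ ->] := Hs k.
have -> : x + t_ k *: (u_ k - s_ k *: x) =
    (1 - t_ k * s_ k) *: x + t_ k *: u_ k.
  by rewrite scalerBl scale1r scalerBr scalerA addrA addrAC.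
apply: XD; apply: XZ => //; rewrite subr_gt0.
rewrite /t_ mulrC ltr_pdivrMr ?ltr_wpDr// mul1r ltrDr//.
Qed.

Lemma support_indicator : (fun y => h y + indicator X y)%E = h.
Proof.
apply/funext => y; rewrite /indicator; case: ifPn => [_|/negP].
  by rewrite adde0.
rewrite inE /effdom /= => /negP; rewrite -leNgt leye_eq => /eqP ->.
by rewrite addye.
Qed.

Lemma sfunZ_le t x : 0 <= t -> X x -> X (t *: x) /\ sfun (t *: x) <= t * sfun x.
Proof.
move=> t0 xX; have tx v : D v -> dot v (t *: x) <= t * sfun x.
  by move=> Dv; rewrite dotZr ler_wpM2l// sfun_ge.
by split; [apply/effdomP; exists (t * sfun x)|exact: sfun_le].
Qed.

(** The bound on [sfun (x + t *: u)] stands for the convexity of [h] along [u].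
    It is compared with the regular subgradient inequality at an arbitrarily
    small step, and the error term vanishes after division by the step. *)
Lemma regular_subdiff_dot_le x v u c : X x -> regular_subdiff h x v ->
  (forall t, 0 < t -> t <= 1 ->
    X (x + t *: u) /\ sfun (x + t *: u) <= sfun x + t * c) ->
  dot v u <= c.
Proof.
move=> xX [_ vh] hu; apply/ler_addgt0Pr => e e0.
have e1 : 0 < e / (enorm u + 1) by rewrite divr_gt0// ltr_wpDl// enorm_ge0.
have cv : (fun k => x + k.+1%:R^-1 *: u) @ \oo --> x.
  rewrite -[X in _ --> X]addr0; apply: cvgD; first exact: cvg_cst.
  by rewrite -[X in _ --> X](scale0r u); apply: cvgZl; exact: cvg_harmonic.
have [k /=] := @filter_ex _ \oo _ _ (cv _ (vh _ e1)).
set t : R := k.+1%:R^-1; have t0 : 0 < t by rewrite invr_gt0.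
have t1 : t <= 1 by rewrite invf_le1// ler1n.
have [uX us] := hu _ t0 t1.
rewrite !sfunE// -EFinD lee_fin addrAC subrr add0r dotZr enormZ gtr0_norm//.
have : enorm u * (e / (enorm u + 1)) <= e.
  rewrite mulrCA ler_piMr// 1?ltW// ltr_pdivrMr ?mul1r ?ltrDl//.
  by rewrite ltr_wpDl// enorm_ge0.
move: (e / (enorm u + 1)) (enorm u) => a b ab; nra.
Qed.

(** Membership in [D] is tested in the directions of [X], and equality in
    [dot v x <= sfun x] in the direction [- x]. *)
Lemma regular_subdiff_support x v : X x -> regular_subdiff h x v <-> face D x v.
Proof.
move=> xX; split=> [vh|/faceP[Dv _ vx]]; last first.
  split=> [|e e0]; first by rewrite sfunE.
  apply: (@filterE _ (nbhs x)) => y; have [yX|] := pselect (X y); last first.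
    rewrite /effdom /= => /negP; rewrite -leNgt leye_eq => /eqP ->.
    by rewrite leey.
  rewrite !sfunE// -EFinD lee_fin dotBr vx.
  have := sfun_ge yX Dv; have := enorm_ge0 (y - x); nra.
have vX u : X u -> dot v u <= sfun u.
  move=> uX; apply: (regular_subdiff_dot_le xX vh) => t t0 t1.
  have tX : X (t *: u) by exact: XZ.
  split; first exact: XD.
  by rewrite (le_trans (sfunD _ _))// lerD2l sfunZ.
apply/faceP; split=> //; first exact/mem_support.
apply/eqP; rewrite eq_le vX//= -lerN2 -dotNr.
apply: (regular_subdiff_dot_le xX vh) => t t0 t1.
have -> : x + t *: - x = (1 - t) *: x by rewrite scalerN scalerBl scale1r.
have t1' : 0 <= 1 - t by rewrite subr_ge0.
have [tX tle] := sfunZ_le t1' xX.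
by split=> //; rewrite (le_trans tle)//; lra.
Qed.

Lemma subdiff_support x v : X x -> subdiff h x v <-> face D x v.
Proof.
move=> xX; split=> [[_ [x_ [v_ [xc hc vr vc]]]]|xv]; last first.
  split; first by rewrite sfunE.
  exists (fun=> x), (fun=> v); split; try exact: cvg_cst.
  by move=> k; apply/regular_subdiff_support.
have xX_ k : X (x_ k).
  by have [+ _] := vr k; rewrite /effdom /= fin_numElt => /andP[].
have vF k : face D (x_ k) (v_ k) by apply/regular_subdiff_support.
have hc' : (fun k => sfun (x_ k)) @ \oo --> sfun x.
  by move: hc; rewrite [in X in _ --> X -> _]sfunE// => /fine_cvg.
have dc : (fun k => dot (v_ k) (x_ k)) @ \oo --> dot v x.
  exact: cvg_dot.
apply/faceP; split=> //.
  by rewrite (closure_id D).1//; apply/closureP; exists v_ => // k; case: (vF k).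
suff dc' : (fun k => dot (v_ k) (x_ k)) @ \oo --> sfun x.
  exact: (cvg_unique _ dc dc').
rewrite (_ : (fun k => _) = (fun k => sfun (x_ k)))//.
by apply/funext => k; have /faceP[] := vF k.
Qed.

Definition projected_faces : set 'rV[R]_n :=
  \bigcup_(x in polar_cone Dinf)
    proj_set (polar_cone (face Dinf x)) (face D x).

Local Notation U := projected_faces.

Lemma projected_facesP w : U w <-> exists x v,
  face D x v /\ proj (polar_cone (face Dinf x)) v w.
Proof.
split=> [[x _ [v xv vw]]|[x [v [xv vw]]]]; first by exists x, v.
exists x; last by exists v.
by apply: sub_effdom_polar => //; have /faceP[] := xv.
Qed.

(** Faces do not change when [x] is multiplied by a positive number, so every
    projected face is already visible arbitrarily close to the origin. *)
Lemma projected_faces_small w e : U w -> 0 < e -> exists x v,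
  [/\ X x, enorm x <= e, `|sfun x| <= e, face D x v
    & proj (tangent_cone X x) v w].
Proof.
move=> /projected_facesP[x [v [xv vw]]] e0.
have /faceP[Dv xX vx] := xv.
pose t := e / (1 + enorm x + `|sfun x|).
have d0 : 0 < 1 + enorm x + `|sfun x|.
  by rewrite -addrA ltr_wpDr// addr_ge0// enorm_ge0.
have t0 : 0 < t by rewrite divr_gt0.
exists (t *: x), v; have tX : X (t *: x) by exact: XZ.
have te r : 0 <= r -> r <= enorm x + `|sfun x| -> t * r <= e.
  move=> r0 rx; rewrite /t mulrAC ler_pdivrMr// ler_pM2l//; lra.
split=> //.
- rewrite enormZ gtr0_norm// te ?enorm_ge0// lerDl//.
- rewrite sfunZ// normrM gtr0_norm// te// lerDr enorm_ge0//.
- by rewrite faceZ.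
- by rewrite tangent_effdom// faceZ.
Qed.

Lemma projected_faces_sequence (w_ : nat -> 'rV[R]_n) : (forall k, U (w_ k)) ->
  exists x_ v_ : nat -> 'rV[R]_n,
  [/\ [/\ forall k, X (x_ k), x_ @ \oo --> (0 : 'rV[R]_n)
        & (h \o x_) @ \oo --> h 0],
      forall k, subdiff (fun y => h y + indicator X y)%E (x_ k) (v_ k)
    & forall k, proj (tangent_cone X (x_ k)) (v_ k) (w_ k)].
Proof.
move=> Uw; have ex k : exists xv : 'rV[R]_n * 'rV[R]_n,
    [/\ X xv.1, enorm xv.1 <= k.+1%:R^-1, `|sfun xv.1| <= k.+1%:R^-1,
       face D xv.1 xv.2 & proj (tangent_cone X xv.1) xv.2 (w_ k)].
  have [||x [v xv]] := @projected_faces_small (w_ k) k.+1%:R^-1; first exact: Uw.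
    by rewrite invr_gt0.
  by exists (x, v).
have [xv Hxv] := choice ex.
exists (fun k => (xv k).1), (fun k => (xv k).2).
rewrite support_indicator; split=> [|k|k]; last 2 first.
- by have [xX _ _ xF _] := Hxv k; apply/subdiff_support.
- by case: (Hxv k).
split=> [k||]; first by case: (Hxv k).
  apply: (cvg_to_enorm (@cvg_harmonic R)) => k.
  by rewrite subr0; case: (Hxv k).
have -> : h \o (fun k => (xv k).1) = (fun k => (sfun (xv k).1)%:E).
  by apply/funext => k /=; rewrite sfunE//; case: (Hxv k).
rewrite sfunE//; have -> : sfun 0 = 0.
  apply/eqP; rewrite eq_le; apply/andP; split.
    by apply: sfun_le => // v _; rewrite dot0r.
  by have [v Dv] := D_neq0; have := sfun_ge X0 Dv; rewrite dot0r.
apply: cvg_EFin; first exact: nearW.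
apply/cvgrPdist_le => r r0.
have /cvgrPdist_le/(_ r r0) := @cvg_harmonic R; apply: filterS => k /=.
rewrite !sub0r !normrN => kr; case: (Hxv k) => _ _ + _ _ => /le_trans; apply.
by rewrite (le_trans _ kr)// ler_norm.
Qed.

Lemma projected_faces_of_subdiff x v w : X x ->
  subdiff (fun y => h y + indicator X y)%E x v ->
  proj (tangent_cone X x) v w -> U w.
Proof.
move=> xX; rewrite support_indicator => /subdiff_support => /(_ xX) xv.
by rewrite tangent_effdom// => vw; apply/projected_facesP; exists x, v.
Qed.

Lemma proj_subdiff_closure : proj_subdiff X h 0 = closure U.
Proof.
apply/seteqP; split=> [w [x_ [v_ [w_ [[xX xc hc] xv vw wc]]]]|w].
  apply/closureP; exists w_ => // k.
  exact: (projected_faces_of_subdiff (xX k) (xv k) (vw k)).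
move=> /closureP[w_ Uw wc].
have [x_ [v_ [H1 H2 H3]]] := projected_faces_sequence Uw.
by exists x_, v_, w_.
Qed.

Lemma horizon_proj_subdiff_closure :
  horizon_proj_subdiff X h 0 = horizon_cone (closure U).
Proof.
apply/seteqP; split=> [w [x_ [v_ [w_ [l_ [[l0 lc] [xX xc hc] xv vw wc]]]]]|].
  exists w_, l_; split=> // k; apply: subset_closure.
  exact: (projected_faces_of_subdiff (xX k) (xv k) (vw k)).
move=> w [y_ [l_ [Uy l0 lc yc]]].
have ex k : exists u, U u /\ enorm (u - y_ k) <= 1.
  by have [u] := closure_enorm (Uy k) ltr01; exists u.
have [w_ Hw] := choice ex.
have [|x_ [v_ [H1 H2 H3]]] := @projected_faces_sequence w_.
  by move=> k; case: (Hw k).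
exists x_, v_, w_, l_; split=> //.
rewrite (_ : (fun k => _) = (fun k => l_ k *: y_ k + l_ k *: (w_ k - y_ k))).
  rewrite -[X in _ --> X]addr0; apply: cvgD => //.
  apply: (cvg_to_enorm lc) => k; rewrite subr0 enormZ gtr0_norm//.
  by rewrite ler_piMr ?(ltW (l0 k))//; case: (Hw k).
by apply/funext => k; rewrite -scalerDr addrC subrK.
Qed.

(** * Lipschitz constants and projected faces *)

(** Existence of subgradients in the relative interior.  A vector
    orthogonal to [X] can be added to [v] without changing [dot v a] for [a] in
    [X], hence without leaving [D].  The map [f] picks one representative of
    [v] modulo such vectors, and the representatives of near-maximisers form a
    bounded set: bounds on [dot v y] and on the values of [h] at [y - e a] and at
    [a] confine the coordinates [dot v a] for [a] in a spanning family. *)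
Lemma core_face_nonempty y : X y -> is_core X y -> face D y !=set0.
Proof.
move=> yX yc; have [m [A [XA spanA]]] := exists_spanning_matrix X.
have /choice[e_ He] : forall i, exists e : R, 0 < e /\ X (y - e *: row i A).
  by move=> i; have [e e0 Xe] := yc _ (XA i); exists e.
pose f v := v *m A^T *m pinvmx A^T.
have dot_f v a : X a -> dot (f v) a = dot v a.
  move=> /spanA/submxP[c ->].
  by rewrite !dot_mulmx trmx_mul !mulmxA /f mulmxKpV// submxMl.
have f_D v : D v -> D (f v).
  by move=> Dv; apply/mem_support => a aX; rewrite dot_f// sfun_ge.
pose bnd i := `|(sfun y - 1 - sfun (y - e_ i *: row i A)) / e_ i| +
  `|sfun (row i A)|.
have f_bnd v : D v -> sfun y - 1 <= dot v y ->
    enorm (f v) <= \sum_i bnd i * enorm (row i (pinvmx A^T)).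
  move=> Dv vy; rewrite /f mulmx_sum_row (le_trans (ler_enorm_sum _ _))//.
  apply: ler_sum => i _; rewrite enormZ ler_wpM2r ?enorm_ge0//.
  have -> : (v *m A^T) 0 i = dot v (row i A).
    by rewrite mxE; apply: eq_bigr => j _; rewrite !mxE.
  have [e0 Xe] := He i.
  have := sfun_ge Xe Dv; rewrite dotBr dotZr => h1.
  have h2 : (sfun y - 1 - sfun (y - e_ i *: row i A)) / e_ i <=
      dot v (row i A).
    by rewrite ler_pdivrMr// mulrC; lra.
  exact: (ler_norm_between h2 (sfun_ge (XA i) Dv)).
have [v1 Dv1 v1y] : exists2 v, D v & sfun y - 1 <= dot v y.
  apply: contrapT => /forall2NP Dn.
  have : sfun y <= sfun y - 1; last by lra.
  apply: sfun_le => // v Dv; have [//|/negP] := Dn v.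
  by rewrite -ltNge => /ltW.
set B := \sum_i _ in f_bnd.
pose V := D `&` [set v | enorm v <= B].
have cV : compact V.
  apply: bounded_closed_compact; first by apply/bounded_setP; exists B => v [].
  apply: closedI => //.
  have ce : continuous (@enorm R n).
    by move=> v; exact: (cvg_enorm (@cvg_id _ (nbhs v))).
  exact: (proj1 (continuous_closedP _) ce _ (@closed_le _ B)).
have cy : continuous (dot^~ y).
  by move=> v; exact: (cvg_dot (@cvg_id _ (nbhs v)) (cvg_cst y)).
have [|v /set_mem[Dv _] vmax] := compact_EVT_max _ cV (continuous_subspaceT cy).
  by exists (f v1); split; [exact: f_D|exact: f_bnd].
have vmax' u : D u -> sfun y - 1 <= dot u y -> dot u y <= dot v y.
  move=> Du uy; rewrite -(dot_f u)//; apply: vmax; rewrite inE; split.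
    exact: f_D.
  exact: f_bnd.
exists v; split=> // u Du.
have [|/ltW uy] := leP (sfun y - 1) (dot u y); first exact: vmax'.
by rewrite (le_trans uy)// (le_trans v1y)// vmax'.
Qed.

Lemma exists_projected x v : face D x v ->
  exists2 w, U w & proj (polar_cone (face Dinf x)) v w.
Proof.
move=> xv; have K0 : polar_cone (face Dinf x) !=set0.
  by exists 0; case: (polar_convex_cone (face Dinf x)).
have [w vw] := proj_nonempty v (@polar_closed _ _ _) K0.
by exists w => //; apply/projected_facesP; exists x, v.
Qed.

(** In the relative interior the normal cone of the domain is orthogonal to the
    whole domain.  So a subgradient may be replaced by its projection on the
    tangent cone in the inequality [sfun y - sfun a <= dot v (y - a)]. *)
Lemma core_lipschitz L y a : (forall w, U w -> enorm w <= L) ->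
  X y -> is_core X y -> X a -> sfun y - sfun a <= L * enorm (y - a).
Proof.
move=> UL yX yc aX; have [v yv] := core_face_nonempty yX yc.
have yD : polar_cone Dinf y by exact: sub_effdom_polar.
have [w Uw vw] := exists_projected yv.
have [_ zF _] := moreau (face_horizon_closed yD)
  (face_horizon_convex_cone yD) vw.
have z0 : dot (v - w) a = 0.
  move: zF; rewrite face_horizonE// horizon_support// => -[zX zy].
  have [e e0 /zX] := yc _ aX; rewrite dotBr zy sub0r dotZr oppr_le0 pmulr_rge0//.
  by move=> za; apply/eqP; rewrite eq_le za zX.
have zy : dot (v - w) y = 0.
  by move: zF; rewrite face_horizonE// => -[].
have /faceP[Dv _ vy] := yv.
have va := sfun_ge aX Dv.
have : sfun y - sfun a <= dot w (y - a).
  by move: z0 zy; rewrite dotBr !dotBl; lra.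
move=> /le_trans; apply; apply: (le_trans (cauchy_schwarz _ _)).
by rewrite ler_wpM2r ?enorm_ge0// UL.
Qed.

(** The core of the theorem.  If [w] is the projection of a subgradient [v] on
    the tangent cone at [x], then [h] increases in the direction [w] at rate at
    least [dot v w], which is the square of the norm of [w].  Conversely, both
    points are pushed into the relative interior by the same vector, where
    [core_lipschitz] applies. *)
Lemma lipschitz_projected_faces L : 0 <= L ->
  (forall a b, X a -> X b -> sfun a - sfun b <= L * enorm (a - b)) <->
  (forall w, U w -> enorm w <= L).
Proof.
move=> L0; split=> [lip w|UL a b aX bX].
  move=> /projected_facesP[x [v [xv]]].
  have /faceP[Dv xX vx] := xv; have xD := sub_effdom_polar xX.
  move=> vw; have [wT _ vww] := moreau (face_horizon_closed xD)
    (face_horizon_convex_cone xD) vw.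
  move: wT; rewrite -tangent_effdom// => -[t_ [w_ [t0 _ wc Xw]]].
  have : dot v w <= L * enorm w.
    have h1 : (fun k => dot v (w_ k)) @ \oo --> dot v w.
      exact: (cvg_dot (cvg_cst v) wc).
    have h2 : (fun k => L * enorm (w_ k)) @ \oo --> L * enorm w.
      by apply: cvgMr; exact: cvg_enorm.
    apply: (ler_cvg_to h1 h2); apply: nearW => k.
    have := lip _ _ (Xw k) xX; rewrite addrAC subrr add0r enormZ gtr0_norm//.
    have := sfun_ge (Xw k) Dv; rewrite dotDr vx dotZr => h3 h4.
    by rewrite -(ler_pM2l (t0 k)) mulrCA; lra.
  have -> : dot v w = enorm w ^+ 2.
    by rewrite enorm_sqr; apply/eqP; rewrite -subr_eq0 -dotBl vww.
  have [->|w0] := eqVneq w 0; first by rewrite enorm0.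
  by rewrite expr2 ler_pM2r// enorm_gt0.
have [x0 x0X x0c] := exists_core (effdom_convex_cone).
have cX := effdom_convex_cone.
rewrite lerBlDr; apply: sfun_le => // v Dv.
(* Moving both points by [t *: x0] into the relative interior keeps their
   difference; then [t] tends to 0. *)
have ht t : 0 < t ->
    dot v a + t * dot v x0 <= L * enorm (a - b) + sfun b + t * sfun x0.
  move=> t0; have tX z : X z -> X (z + t *: x0).
    by move=> zX; apply: XD => //; exact: XZ.
  have := core_lipschitz UL (tX _ aX) (core_add cX aX x0c t0) (tX _ bX).
  rewrite opprD addrACA subrr addr0.
  have := sfunD bX (XZ t0 x0X); rewrite sfunZ//.
  by have := sfun_ge (tX _ aX) Dv; rewrite dotDr dotZr; lra.
have xv := sfun_ge x0X Dv.
apply/ler_addgt0Pr => e e0.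
have d0 : 0 < sfun x0 - dot v x0 + 1 by lra.
have := ht (e / (sfun x0 - dot v x0 + 1)) (divr_gt0 e0 d0).
have : e / (sfun x0 - dot v x0 + 1) * (sfun x0 - dot v x0) <= e.
  by rewrite mulrAC ler_pdivrMr// ler_pM2l//; lra.
lra.
Qed.

(** * The Lipschitz modulus at the origin *)

(** The difference quotient of the positively homogeneous [h] is invariant
    under scaling, so each of its values is attained arbitrarily close to the
    origin. *)
Lemma ratio_le_sup a b (V : set ('rV[R]_n * 'rV[R]_n)) :
  X a -> X b -> a != b ->
  within [set p : 'rV[R]_n * 'rV[R]_n | [/\ X p.1, X p.2 & p.1 != p.2]]
    (nbhs ((0 : 'rV[R]_n), (0 : 'rV[R]_n))) V ->
  ((`|sfun a - sfun b| / enorm (a - b))%:E <=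
   ereal_sup [set (`|fine (h p.1) - fine (h p.2)| / enorm (p.1 - p.2))%:E
             | p in V])%E.
Proof.
move=> aX bX ab /nbhs00_enorm[e e0 eV].
have [t t0 [ta tb]] := exists_scale a b e0.
apply: ereal_sup_ubound; exists (t *: a, t *: b) => /=.
  apply: (eV _ _ ta tb); split; [exact: XZ|exact: XZ|].
  by rewrite /= -subr_eq0 -scalerBr scaler_eq0 gt_eqF//= subr_eq0.
rewrite -!/(sfun _) !sfunZ// -mulrBr -scalerBr normrM enormZ gtr0_norm//.
by rewrite -mulf_div divff ?gt_eqF// mul1r.
Qed.

Lemma isolated_effdom a : isolated X 0 -> X a -> a = 0.
Proof.
move=> [_ [V /nbhs_ballP[e /= e0 eV] VX]] aX.
have [t t0 [ta _]] := exists_scale a 0 e0.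
have : (V `&` X) (t *: a).
  split; last exact: XZ.
  apply: eV; rewrite -ball_normE /= sub0r normrN.
  exact: le_lt_trans (norm_le_enorm _) ta.
by rewrite VX => /eqP; rewrite scaler_eq0 gt_eqF//= => /eqP.
Qed.

(** By homogeneity the local modulus at the origin is a global Lipschitz
    constant on the domain.  When the origin is isolated in the domain, the
    domain is reduced to it. *)
Lemma lip_le_lipschitz L : 0 <= L -> (lip X h 0 <= L%:E)%E <->
  (forall a b, X a -> X b -> sfun a - sfun b <= L * enorm (a - b)).
Proof.
move=> L0; rewrite /lip; case: asboolP => [i0|ni0].
  split=> // _ a b /(isolated_effdom i0)-> /(isolated_effdom i0)->.
  by rewrite !subrr enorm0 mulr0.
split=> [lipL a b aX bX|hL].
  have [->|ab] := eqVneq a b; first by rewrite !subrr enorm0 mulr0.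
  have ab0 : 0 < enorm (a - b) by rewrite enorm_gt0 subr_eq0.
  rewrite (le_trans (ler_norm _))// -ler_pdivrMr// -lee_fin.
  apply: (le_trans _ lipL); apply: le_ereal_inf_tmp => _ [V hV <-].
  exact: ratio_le_sup.
pose E := [set p : 'rV[R]_n * 'rV[R]_n | [/\ X p.1, X p.2 & p.1 != p.2]].
apply: (@le_trans _ _ (ereal_sup [set (`|fine (h p.1) - fine (h p.2)| /
    enorm (p.1 - p.2))%:E | p in E])).
  by apply: ereal_inf_lbound; exists E => //; exact: withinT.
apply: ge_ereal_sup => _ [[a b] /= [/= aX bX ab] <-]; rewrite lee_fin.
rewrite ler_pdivrMr ?enorm_gt0 ?subr_eq0// ler_norml; apply/andP; split.
  by rewrite lerNl opprB enormB; exact: hL.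
exact: hL.
Qed.

Lemma lip_ge0 : (0 <= lip X h 0)%E.
Proof.
rewrite /lip; case: asboolP => // ni0.
have [a aX a0] : exists2 a, X a & a != 0.
  apply: contrapT => /forall2NP Xn; apply: ni0; split; first by rewrite inE.
  exists setT; first exact: filterT.
  rewrite setTI; apply/seteqP; split=> [a aX|_ ->]; last exact: X0.
  by have [//|/negP/negPn/eqP] := Xn a.
apply: le_ereal_inf_tmp => _ [V hV <-].
apply: le_trans (ratio_le_sup aX X0 a0 hV).
by rewrite lee_fin divr_ge0 ?enorm_ge0.
Qed.

Lemma projected_faces_nonempty : U !=set0.
Proof.
have [v Dv] := D_neq0.
have [|w Uw _] := @exists_projected 0 v; last by exists w.
by split=> // u _; rewrite !dot0r.
Qed.

Lemma sup_enorm_le L : (ereal_sup [set (enorm v)%:E | v in U] <= L%:E)%E <->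
  (forall w, U w -> enorm w <= L).
Proof.
split=> [UL w Uw|UL].
  by rewrite -lee_fin (le_trans _ UL)//; apply: ereal_sup_ubound; exists w.
by apply: ge_ereal_sup => _ [w Uw <-]; rewrite lee_fin UL.
Qed.

Lemma sup_enorm_ge0 : (0 <= ereal_sup [set (enorm v)%:E | v in U])%E.
Proof.
have [w Uw] := projected_faces_nonempty.
apply: (@le_trans _ _ (enorm w)%:E); first by rewrite lee_fin enorm_ge0.
by apply: ereal_sup_ubound; exists w.
Qed.

Lemma lip_sup_enorm : lip X h 0 = ereal_sup [set (enorm v)%:E | v in U].
Proof.
apply: eq_ereal_ge0; [exact: lip_ge0|exact: sup_enorm_ge0|move=> L L0].
rewrite lip_le_lipschitz// sup_enorm_le; exact: lipschitz_projected_faces.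
Qed.

Lemma sup_enorm_excess : ereal_sup [set (enorm v)%:E | v in U] =
  ereal_sup [set excess (face D x) (face Dinf x) | x in polar_cone Dinf].
Proof.
have dE x v w : face D x v -> proj (polar_cone (face Dinf x)) v w ->
    dist v (face Dinf x) = (enorm w)%:E.
  move=> /faceP[_ xX _]; have xD := sub_effdom_polar xX.
  apply: dist_convex_cone; first exact: face_horizon_closed.
  exact: face_horizon_convex_cone.
apply/eqP; rewrite eq_le; apply/andP; split.
  apply: ge_ereal_sup => _ [w Uw <-].
  have [x [v [xv vw]]] := (projected_facesP _).1 Uw.
  have /faceP[_ xX _] := xv.
  apply: (@le_trans _ _ (excess (face D x) (face Dinf x))); last first.
    by apply: ereal_sup_ubound; exists x => //; exact: sub_effdom_polar.
  rewrite /excess; case: eqP => [F0|_]; first by rewrite F0 in xv.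
  by apply: ereal_sup_ubound; exists v => //; exact: dE.
apply: ge_ereal_sup => _ [x xD <-]; rewrite /excess; case: eqP => _.
  exact: sup_enorm_ge0.
apply: ge_ereal_sup => _ [v xv <-]; have [w Uw vw] := exists_projected xv.
by rewrite (dE _ _ _ xv vw); apply: ereal_sup_ubound; exists w.
Qed.

Lemma lipschitz_bounded :
  locally_lipschitz_rel X h 0 <-> bounded_set (closure U).
Proof.
rewrite /locally_lipschitz_rel lip_sup_enorm -sup_enorm_closure bounded_setP.
have s0 := sup_enorm_ge0; rewrite -sup_enorm_closure in s0.
split=> [soo|[M UM]].
  exists (fine (ereal_sup [set (enorm v)%:E | v in closure U])) => w Uw.
  rewrite -lee_fin fineK; first by apply: ereal_sup_ubound; exists w.
  by rewrite ge0_fin_numE.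
apply: (@le_lt_trans _ _ M%:E); last exact: ltry.
by apply: ge_ereal_sup => _ [w Uw <-]; rewrite lee_fin UM.
Qed.

(** * Projection of [D] and bounded faces *)

Lemma proj_sub_subdiff : proj_set (polar_cone Dinf) D `<=` U.
Proof.
move=> w [v Dv vw]; apply/projected_facesP; exists 0, v; split.
  by split=> // u _; rewrite !dot0r.
rewrite (_ : face Dinf 0 = Dinf)//; apply/seteqP; split=> u; first by case.
by move=> Du; split=> // z _; rewrite !dot0r.
Qed.

(** A bounded face has no horizon direction, so the projection is on the whole
    space. *)
Lemma bounded_face_sub F : exposed_face D F -> bounded_set F -> F `<=` U.
Proof.
move=> [x ->] /bounded_setP[M FM] v xv.
have /faceP[Dv xX _] := xv; have xD := sub_effdom_polar xX.
have F0 : face Dinf x = [set 0].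
  apply/seteqP; split=> [w wF|_ ->]; last first.
    by have [] := face_horizon_convex_cone xD.
  have [_ _ FZ] := face_horizon_convex_cone xD.
  apply/eqP; rewrite -enorm_eq0 eq_le enorm_ge0 andbT; apply/ler_addgt0Pl => e e0.
  have M0 : 0 <= M by rewrite (le_trans (enorm_ge0 v))// FM.
  (* A horizon direction longer than [e] would lead from [v] to a point
     farther than the diameter bound [2 * M]. *)
  have t0 : 0 < (2 * M + 1) / e by rewrite divr_gt0//; lra.
  have := FM _ (face_add_horizon xD xv (FZ _ _ t0 wF)).
  have := ler_enormD (v + ((2 * M + 1) / e) *: w) (- v).
  rewrite addrAC subrr add0r enormN enormZ gtr0_norm// => h1 h2.
  have h3 := FM _ xv.
  have : (2 * M + 1) / e * enorm w <= 2 * M + 1 by lra.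
  by rewrite mulrAC ler_pdivrMr// ler_pM2l; lra.
apply/projected_facesP; exists x, v; split=> //.
split=> [z|z _]; first by rewrite F0 => ->; rewrite dot0r.
by rewrite subrr enorm0 enorm_ge0.
Qed.

(** * Polyhedral sets and piecewise linear support functions *)

(** By Minkowski's theorem [h] is the maximum of finitely many linear forms on
    a polyhedral domain. *)
Lemma polyhedral_support : polyhedral D -> exists P Q : seq 'rV[R]_n,
  [/\ forall p, p \in P -> D p,
      X = [set x | forall q, q \in Q -> dot q x <= 0]
    & forall x, X x -> exists2 p, p \in P &
        sfun x = dot p x /\ forall p', p' \in P -> dot p' x <= dot p x].
Proof.
move=> /polyhedral_generators[P [Q [DP DQ DPQ]]]; exists P, Q.
(* Without points, [0 <= -1] would hold on [D]. *)
have P0 : P != [::].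
  apply/eqP => P0; have [v Dv] := D_neq0.
  have /(_ _ Dv) : forall u, D u -> dot 0 u <= -1.
    by apply: DPQ => [p|q _]; rewrite ?P0// dot0l.
  by rewrite dot0l; lra.
have max x : (forall q, q \in Q -> dot q x <= 0) -> exists2 p, p \in P &
    (forall v, D v -> dot v x <= dot p x) /\
    forall p', p' \in P -> dot p' x <= dot p x.
  move=> xQ; have [p pP pmax] := exists_max_seq (dot^~ x) P0.
  exists p => //; split=> // v Dv; rewrite dotC.
  by apply: (DPQ _ _ _ _ _ Dv) => [p' /pmax|q /xQ]; rewrite dotC.
have XQ x q : X x -> q \in Q -> dot q x <= 0.
  move=> xX qQ; suff : Dinf q by rewrite horizon_support => /(_ _ xX).
  have [v Dv] := D_neq0; apply: (@horizon_cone_ray _ _ _ v) => k.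
  exact: DQ.
split=> //.
  apply/seteqP; split=> x; first by move=> xX q; exact: XQ.
  by move=> /max[p _ [pmax _]]; apply/effdomP; exists (dot p x).
move=> x xX; have [p pP [pmax pP']] := max x (XQ x ^~ xX).
exists p => //; split=> //; apply/eqP; rewrite eq_le sfun_le//=.
by rewrite sfun_ge//; exact: DP.
Qed.

Lemma polyhedral_piecewise_linear : polyhedral D -> piecewise_linear h.
Proof.
move=> /polyhedral_support[P [Q [DP XQ Pmax]]].
pose a (i : 'I_(size P)) := nth 0 P i.
pose s i := [seq (q, 0 : R) | q <- Q] ++ [seq (p - a i, 0) | p <- P].
have sE i x : ineqs (s i) x <->
    X x /\ forall p, p \in P -> dot p x <= dot (a i) x.
  rewrite XQ; split=> [xs|[xQ xP] _ /[!mem_cat]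
      /orP[/mapP[q qQ ->]|/mapP[p pP ->]]].
  - split=> [q qQ|p pP].
      by apply: (xs (q, 0)); rewrite mem_cat (map_f (fun q => (q, 0))).
    rewrite -subr_le0 -dotBl; apply: (xs (p - a i, 0)).
    by rewrite mem_cat (map_f (fun p => (p - a i, 0))) ?orbT.
  - exact: xQ.
  - by rewrite dotBl subr_le0 xP.
exists (size P), (fun i => ineqs (s i)), a, (fun=> 0); split=> [i||i x].
- by apply/polyhedralP; exists (s i).
- apply/seteqP; split=> x; last by move=> [i _ /sE[]].
  move=> xX; have [p pP [_ pmax]] := Pmax _ xX.
  have ip := pP; rewrite -index_mem in ip.
  exists (Ordinal ip) => //; apply/sE; split=> // p' p'P.
  by rewrite /a /= nth_index// pmax.
- move=> /sE[xX xmax]; rewrite sfunE// addr0; have [p pP [-> pmax]] := Pmax _ xX.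
  by congr EFin; apply/eqP; rewrite eq_le xmax// pmax// mem_nth.
Qed.

(** [D] is cut out by the inequalities [dot v x <= h x]; on each piece the right
    side is affine, and finitely many of them suffice by
    [polyhedral_dual]. *)
Lemma piecewise_linear_polyhedral : piecewise_linear h -> polyhedral D.
Proof.
move=> [m [C [a [b [pC XC hC]]]]].
have -> : D = [set v | forall i, [set u | forall x, C i x ->
    dot u x <= dot (a i) x + b i] v].
  have CX i x : C i x -> X x by move=> ix; rewrite XC; exists i.
  have sE i x : C i x -> sfun x = dot (a i) x + b i.
    by move=> ix; rewrite /sfun (hC _ _ ix).
  apply/seteqP; split=> v /= vD => [i x ix|].
    by rewrite -sE// sfun_ge//; exact: CX ix.
  by apply/mem_support => x; rewrite XC => -[i _ ix]; rewrite (sE _ _ ix) vD.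
by apply: polyhedral_forall => i; exact: polyhedral_dual.
Qed.

(** A maximum of finitely many linear forms is Lipschitz, with constant the sum
    of their norms. *)
Lemma polyhedral_bounded : polyhedral D -> bounded_set (closure U).
Proof.
move=> /polyhedral_support[P [Q [DP XQ Pmax]]].
apply/lipschitz_bounded; apply: (@le_lt_trans _ _ (\sum_(p <- P) enorm p)%:E).
  apply/lip_le_lipschitz; first by apply: sumr_ge0 => p _; exact: enorm_ge0.
  move=> a b aX bX; have [p pP [-> _]] := Pmax _ aX.
  have pb := sfun_ge bX (DP _ pP).
  apply: (@le_trans _ _ (dot p (a - b))); first by rewrite dotBr; lra.
  rewrite (le_trans (cauchy_schwarz _ _))// ler_wpM2r ?enorm_ge0//.
  rewrite (big_rem p)//= lerDl; apply: sumr_ge0 => q _; exact: enorm_ge0.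
exact: ltry.
Qed.

End SupportFunction.

Theorem corollary3p1 (R : realType) (n : nat) (h : 'rV[R]_n -> \bar R)
    (D : set 'rV[R]_n)
    (h_proper : proper_fun h) (h_lsc : lower_semicontinuous h)
    (h_sublinear : sublinear h)
    (D_closed : closed D) (D_convex : @convex_set R 'rV[R]_n D)
    (hD : h = support_fun D) :
  let Dinf := horizon_cone D in
  let dh := proj_subdiff (effdom h) h 0 in
  [/\
      (forall x, polar_cone Dinf x -> face Dinf x !=set0) /\
      (forall x, polar_cone Dinf x -> face D x !=set0 ->
        horizon_cone (face D x) = face Dinf x),

      [/\ dh !=set0 /\ closed dh,
          dh = closure (\bigcup_(x in polar_cone Dinf)
                  proj_set (polar_cone (face Dinf x)) (face D x)),
          horizon_proj_subdiff (effdom h) h 0 = horizon_cone dh,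
          proj_set (polar_cone Dinf) D `<=` dh
        & forall F, exposed_face D F -> bounded_set F -> F `<=` dh],
      locally_lipschitz_rel (effdom h) h 0 <-> bounded_set dh,
      lip (effdom h) h 0 = ereal_sup [set (enorm v)%:E | v in dh] /\
      ereal_sup [set (enorm v)%:E | v in dh] =
        ereal_sup [set excess (face D x) (face Dinf x) | x in polar_cone Dinf]
    &
      (polyhedral D <-> piecewise_linear h) /\
      (polyhedral D -> bounded_set dh)].
Proof.
move=> Dinf dh.
have D0 : D !=set0.
  apply/set0P/eqP => D0; have [_ /(_ 0)] := h_proper.
  by rewrite hD /support_fun D0 image_set0 ereal_sup0 ltxx.
have dhE : dh = closure (projected_faces D).
  by rewrite /dh hD; exact: proj_subdiff_closure.
split.
- by split=> x xD; [exact: face_horizon_nonempty|exact: horizon_face].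
- split.
  + rewrite dhE; split; last exact: closed_closure.
    have [w Uw] := projected_faces_nonempty D_closed D_convex D0.
    by exists w; exact: subset_closure.
  + exact: dhE.
  + by rewrite dhE hD; exact: horizon_proj_subdiff_closure.
  + rewrite dhE; apply: subset_trans (@subset_closure _ _).
    exact: proj_sub_subdiff.
  + move=> F DF bF; rewrite dhE; apply: subset_trans (@subset_closure _ _).
    exact: bounded_face_sub.
- by rewrite dhE hD; exact: lipschitz_bounded.
- by rewrite dhE hD sup_enorm_closure lip_sup_enorm// sup_enorm_excess.
- rewrite dhE hD; split; last exact: polyhedral_bounded.
  split; first exact: polyhedral_piecewise_linear.
  exact: piecewise_linear_polyhedral.
Qed.
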